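(* The set of functionals $(S,Q)\mapsto\log f_\alpha(S,Q)$, where $f_\alpha$ ranges over $\Delta(\mathcal{A},\le)$ (with $f\in\Delta(\mathcal{G},\le)$, $\alpha\ge1$), is convex under pointwise convex combinations. Explicitly: if $f_\alpha,g_\beta\in\Delta(\mathcal{A},\le)$, $\lambda\in[0,1]$, $h\in\Delta(\mathcal{G},\le)$ satisfies $\log h(G,P)=\lambda\log f(G,P)+(1-\lambda)\log g(G,P)$ for all nonempty graphs $G$ and $P\in\mathcal{P}(V(G))$, and $\gamma=\lambda\alpha+(1-\lambda)\beta$, then $h_\gamma\in\Delta(\mathcal{A},\le)$.
   Context: Graphs are finite simple undirected; $x\simeq x'$ means equal or adjacent. Strong product $G\boxtimes H$: $(g,h)\simeq(g',h')$ iff $g\simeq g'$ and $h\simeq h'$. $H\le G$ for graphs means a homomorphism $\overline{H}\to\overline{G}$ exists. $\Delta(\mathcal{G},\le)$: maps from graphs to $\mathbb{R}_{\ge0}$, $0$ on the empty graph, $1$ on $K_1$, additive under disjoint union, multiplicative under $\boxtimes$, monotone under $\le$. Probabilistic refinement: for a finite set $X$, $\mathcal{P}(X)$ is the set of probability distributions on $X$ and $\mathcal{P}_n(X)$ the set of $n$-types; for $Q\in\mathcal{P}_n(V(G))$, $G^{n}_{Q}$ is the subgraph of $G^{\boxtimes n}$ induced on the type class of $Q$ (sequences in $V(G)^n$ with empirical distribution $Q$). For $f\in\Delta(\mathcal{G},\le)$, nonempty $G$ and $Q\in\mathcal{P}(V(G))$, $f(G,Q)=\lim_{n}\sqrt[n]{f(G^{n}_{Q_n})}$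 for any sequence $Q_n\in\mathcal{P}_n(V(G))$, $Q_n\to Q$ (this limit exists and is independent of the sequence). A noncommutative graph is a subspace $S\subseteq B(\mathcal{H})$ ($\mathcal{H}$ finite-dimensional) with $I\in S$, $S^*=S$. A cohomomorphism from $T\subseteq B(\mathcal{K})$ to $S\subseteq B(\mathcal{H})$ is a finite family of linear maps $E_i:\mathcal{K}\to\mathcal{H}$ with $\sum_iE_i^*E_i=I$ and $E_i^*SE_j\subseteq T$ for all $i,j$; $T\le S$ if one exists. $\widehat{G}=\operatorname{span}\{|x\rangle\langle x'|:x\simeq x'\}\subseteq B(\mathbb{C}^{V(G)})$, $\mathcal{C}_d=\mathbb{C}I\subseteq B(\mathbb{C}^d)$. $\mathcal{A}$ is the semiring (under $\oplus,\otimes$, up to unitary isomorphism) generated by all $\widehat{G}$ and $\mathcal{C}_d$; its elements have the form $S=\bigoplus_{d=1}^r\widehat{G_d}\otimes\mathcal{C}_d$. For $f\in\Delta(\mathcal{G},\le)$, $\alpha\ge1$, $f_\alpha(S)=\sum_d f(G_d)d^\alpha$. $\Delta(\mathcal{A},\le)$ is the set of $\le$-monotone semiring homomorphisms $\mathcal{A}\to\mathbb{R}_{\ge0}$. For such $S$, let $\pi:\bigsqcup_dV(G_d)\to\{1,\dots,r\}$ send $g\in V(G_d)$ to $d$; for $Q\in\mathcal{P}(\bigsqcup_dV(G_d))$, let $Q_d$ be the normalized restriction of $Q$ to $V(G_d)$, and define $\log f_\alpha(S,Q)=H(\pi_*Q)+\sum_{d=1}^r\pi_*Q(d)\left[\log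 f(G_d,Q_d)+\alpha\log d\right]$, where $H$ is Shannon entropy and terms with $\pi_*Q(d)=0$ are omitted. *)

(* Defs.v *)
From HB Require Import structures.
From mathcomp Require Import all_boot all_order all_algebra.
From mathcomp Require Import all_classical all_reals.
From mathcomp Require Import exp sequences topology normedtype.
From mathcomp Require Import complex.
Set Implicit Arguments. Unset Strict Implicit. Unset Printing Implicit Defensive.
Import Order.TTheory GRing.Theory Num.Theory.
Import numFieldNormedType.Exports.
Local Open Scope classical_set_scope.
Local Open Scope ring_scope.

Record graph := Graph {
  gV : finType;
  gadj : rel gV;
  gadj_sym : symmetric gadj;
  gadj_irr : irreflexive gadj }.

Definition simeq (G : graph) (x y : gV G) : bool := (x == y) || gadj x y.

Definition K1 : graph := @Graph unit (fun _ _ => false) (fun _ _ => erefl) (fun _ => erefl).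

Definition dunion_adj (G H : graph) : rel (gV G + gV H) :=
  fun a b => match a, b with
             | inl x, inl y => gadj x y
             | inr x, inr y => gadj x y
             | _, _ => false end.
Lemma dunion_sym G H : symmetric (@dunion_adj G H).
Proof. by case=> x [] y //=; rewrite gadj_sym. Qed.
Lemma dunion_irr G H : irreflexive (@dunion_adj G H).
Proof. by case=> x /=; rewrite gadj_irr. Qed.
Definition dunion (G H : graph) : graph := Graph (@dunion_sym G H) (@dunion_irr G H).

Definition sprod_adj (G H : graph) : rel (gV G * gV H) :=
  fun a b => (a != b) && simeq a.1 b.1 && simeq a.2 b.2.
Lemma simeq_sym (G : graph) : symmetric (@simeq G).
Proof. by move=> x y; rewrite /simeq eq_sym gadj_sym. Qed.
Lemma sprod_sym G H : symmetric (@sprod_adj G H).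
Proof. by move=> a b; rewrite /sprod_adj eq_sym (simeq_sym a.1) (simeq_sym a.2). Qed.
Lemma sprod_irr G H : irreflexive (@sprod_adj G H).
Proof. by move=> a; rewrite /sprod_adj eqxx. Qed.
Definition sprod (G H : graph) : graph := Graph (@sprod_sym G H) (@sprod_irr G H).

(* H <= G : a homomorphism from the complement of H to the complement of G,
   i.e. a vertex map sending distinct non-adjacent pairs to distinct non-adjacent pairs *)
Definition graph_le (H G : graph) : Prop :=
  exists phi : gV H -> gV G, forall x y, x != y -> ~~ gadj x y ->
      (phi x != phi y) && ~~ gadj (phi x) (phi y).

Definition spectralG (R : realType) (f : graph -> R) : Prop :=
  (forall G, 0 <= f G) /\
  [/\ (forall G, #|gV G| = 0%N -> f G = 0),
      (forall G, #|gV G| = 1%N -> f G = 1),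
      (forall G H, f (dunion G H) = f G + f H),
      (forall G H, f (sprod G H) = f G * f H) &
      (forall G H, graph_le H G -> f H <= f G)].

Definition is_dist (R : realType) (V : finType) (Q : V -> R) : Prop :=
  (forall x, 0 <= Q x) /\ \sum_x Q x = 1.

Definition is_ntype (R : realType) (V : finType) (n : nat) (Q : V -> R) : Prop :=
  is_dist Q /\ exists k : V -> nat, forall x, Q x = (k x)%:R / n%:R.

(* G^n_Q : subgraph of the n-th strong power induced on the type class of Q *)
Definition typeclass (R : realType) (G : graph) (n : nat) (Q : gV G -> R) :=
  {x : {ffun 'I_n -> gV G} | [forall v, #|[set i | x i == v]|%:R == n%:R * Q v]}.
Definition tc_adj R G n Q : rel (@typeclass R G n Q) :=
  fun a b => (a != b) && [forall i, simeq (val a i) (val b i)].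
Lemma tc_sym R G n Q : symmetric (@tc_adj R G n Q).
Proof.
move=> a b; rewrite /tc_adj eq_sym; congr (_ && _).
by apply/forallP/forallP => H i; rewrite simeq_sym.
Qed.
Lemma tc_irr R G n Q : irreflexive (@tc_adj R G n Q).
Proof. by move=> a; rewrite /tc_adj eqxx. Qed.
Definition typegraph R G n Q : graph := Graph (@tc_sym R G n Q) (@tc_irr R G n Q).

Definition is_refine (R : realType) (f : graph -> R) (G : graph) (Q : gV G -> R) (v : R)
  : Prop :=
  forall Qn : nat -> gV G -> R,
    (forall n, is_ntype n.+1 (Qn n)) ->
    (forall x, (fun n => Qn n x) @ \oo --> Q x) ->
    (fun n => f (@typegraph R G n.+1 (Qn n)) `^ (n.+1%:R)^-1) @ \oo --> v.

Definition refine (R : realType) (f : graph -> R) (G : graph) (Q : gV G -> R) : R :=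
  xget 0 [set v | @is_refine R f G Q v].

(* an operator K -> H on C^K, C^H as a matrix indexed by (row in H, column in K) *)
Definition op (R : realType) (I J : finType) := I -> J -> R[i].
Definition opmul (R : realType) (I J K : finType) (A : op R I J) (B : op R J K) : op R I K :=
  fun p q => \sum_r A p r * B r q.
Definition opadj (R : realType) (I J : finType) (A : op R I J) : op R J I :=
  fun p q => (A q p)^*.
Definition opid (R : realType) (I : finType) : op R I I := fun p q => (p == q)%:R.

(* a noncommutative graph: a subspace of B(C^I) given by its membership predicate *)
Record ncgraph (R : realType) := NCG { ncI : finType; ncS : op R ncI ncI -> Prop }.

Definition nc_le (R : realType) (T S : ncgraph R) : Prop :=
  exists (n : nat) (E : 'I_n -> op R (ncI S) (ncI T)),
    (forall p q, \sum_i opmul (opadj (E i)) (E i) p q = @opid R (ncI T) p q) /\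
    (forall i j (X : op R (ncI S) (ncI S)),
        @ncS R S X -> @ncS R T (opmul (opadj (E i)) (opmul X (E j)))).

Definition nc_iso (R : realType) (S T : ncgraph R) : Prop :=
  exists U : op R (ncI T) (ncI S),
    (forall p q, opmul (opadj U) U p q = @opid R _ p q) /\
    (forall p q, opmul U (opadj U) p q = @opid R _ p q) /\
    (forall X : op R (ncI S) (ncI S), @ncS R S X <-> @ncS R T (opmul U (opmul X (opadj U)))).

Definition nc_oplus (R : realType) (S T : ncgraph R) : ncgraph R :=
  @NCG R (ncI S + ncI T)%type (fun X =>
    [/\ @ncS R S (fun a b => X (inl a) (inl b)),
        @ncS R T (fun a b => X (inr a) (inr b)),
        (forall a b, X (inl a) (inr b) = 0) &
        (forall a b, X (inr b) (inl a) = 0)]).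

Definition nc_otimes (R : realType) (S T : ncgraph R) : ncgraph R :=
  @NCG R (ncI S * ncI T)%type (fun X =>
    exists (n : nat) (A : 'I_n -> op R (ncI S) (ncI S)) (B : 'I_n -> op R (ncI T) (ncI T)),
      (forall k, @ncS R S (A k) /\ @ncS R T (B k)) /\
      (forall p q, X p q = \sum_k A k p.1 q.1 * B k p.2 q.2)).

(* An element S = (+)_{d=1}^r  hat(G_d) (x) C_d of A is represented by the list
   [G_1; ...; G_r]; the entry at (0-based) position d has multiplicity d.+1. *)
Definition Arep := seq graph.
Definition Ablock (s : Arep) (d : 'I_(size s)) : graph := nth K1 s d.
Definition Aidx (s : Arep) : finType := {d : 'I_(size s) & (gV (Ablock d) * 'I_d.+1)%type}.
Definition Agen (s : Arep) : finType := {d : 'I_(size s) & (gV (Ablock d) * gV (Ablock d))%type}.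

(* generator |x><x'| (x) I_d of block d *)
Definition Agenop (R : realType) (s : Arep) (k : Agen s) : op R (Aidx s) (Aidx s) :=
  fun p q => [exists i : 'I_(tag k).+1,
                (p == Tagged (fun d : 'I_(size s) => (gV (Ablock d) * 'I_d.+1)%type)
                        ((tagged k).1, i))
             && (q == Tagged (fun d : 'I_(size s) => (gV (Ablock d) * 'I_d.+1)%type)
                        ((tagged k).2, i))]%:R.

(* the noncommutative graph (+)_d hat(G_d) (x) C_d : the span of the generators
   |x><x'| (x) I_d with x ~= x' in G_d *)
Definition Areal (R : realType) (s : Arep) : ncgraph R :=
  @NCG R (Aidx s) (fun X =>
    exists c : Agen s -> R[i],
      (forall k, ~~ simeq (tagged k).1 (tagged k).2 -> c k = 0) /\
      (forall p q, X p q = \sum_k c k * Agenop R k p q)).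

(* Delta(A, <=): <=-monotone semiring homomorphisms A -> R_{>=0}
   (elements of A considered up to unitary isomorphism) *)
Definition spectralA (R : realType) (phi : Arep -> R) : Prop :=
  (forall s, 0 <= phi s) /\
  [/\ phi [::] = 0,
      phi [:: K1] = 1,
      (forall s t u, nc_iso (Areal R u) (nc_oplus (Areal R s) (Areal R t)) ->
                     phi u = phi s + phi t),
      (forall s t u, nc_iso (Areal R u) (nc_otimes (Areal R s) (Areal R t)) ->
                     phi u = phi s * phi t) &
      (forall s t, nc_le (Areal R t) (Areal R s) -> phi t <= phi s)].

Definition f_alpha (R : realType) (f : graph -> R) (alpha : R) (s : Arep) : R :=
  \sum_(d < size s) f (Ablock d) * (d.+1%:R) `^ alpha.

(* Main.v *)
(** Let [V] be the set of all vertices of [T = (+)_d hat(G_d) (x) C_d], made into a graph by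
disjoint union, with multiplicity [m v = d] for [v] in [G_d]; similarly [V'], [m'] for [S].
If the operators [E_i] witness [T <= S], then for every [v] some [E_i] has a nonzero block from
[C^(m v)] over [v] to [C^(m' w)] over some vertex [w =: phi v].  Since [E_i^* S E_j] is
contained in [T], these blocks are multiples of isometries, they overlap in scalars, and
blocks of distinguishable vertices with indistinguishable images are orthogonal.  Tensor powers
of the blocks show [T^n_Q <= S^n_(phi_* Q)] for every [n]-type [Q], where [phi] does not depend
on any spectral point.  Hence [log f_alpha(T, Q) <= log f_alpha(S, phi_* Q)] and likewise for
[g_beta]; the convex combination of both is the same inequality for [h_gamma].  As there are
polynomially many types, [h_gamma(T)^n <= (n+1)^|V| h_gamma(S)^n], so [h_gamma] is monotone.

For an [n]-type [Q] with counts [k], supermultiplicativity of [f] on type classes identifies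
[log f(G, Q)] with [1/n sup_j (1/j) log f(type class of j k)]; passing to the subgraph induced
on the support of [k], an arbitrary sequence of types converging to [Q] is squeezed between
multiples of [k]. *)

Require Import Defs.
From HB Require Import structures.
From mathcomp Require Import all_boot all_order all_algebra.
From mathcomp Require Import all_classical all_reals.
From mathcomp Require Import exp sequences topology normedtype.
From mathcomp Require Import complex interval_inference.
From mathcomp Require Import zify ring lra.
Set Implicit Arguments. Unset Strict Implicit. Unset Printing Implicit Defensive.
Import Order.TTheory GRing.Theory Num.Theory.
Local Open Scope ring_scope.

(** * Graphs, induced subgraphs and powers *)

Section Graphs.

Lemma simeqxx (G : graph) (x : gV G) : simeq x x.
Proof. by rewrite /simeq eqxx. Qed.

(** Contrapositive of the condition on distinct non-adjacent pairs; every comparison of graphs below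
    is made in this form. *)
Lemma graph_le_simeq (H G : graph) (phi : gV H -> gV G) :
  (forall x y, simeq (phi x) (phi y) -> simeq x y) -> graph_le H G.
Proof.
move=> phiP; exists phi => x y xy nxy; rewrite -negb_or; apply/negP => s.
by have := phiP x y s; rewrite /simeq (negbTE xy) (negbTE nxy).
Qed.

Section Induced.
Variables (G : graph) (P : pred (gV G)).
Definition ind_adj : rel {x | P x} := fun a b => gadj (val a) (val b).
Lemma ind_sym : symmetric ind_adj.
Proof. by move=> a b; rewrite /ind_adj gadj_sym. Qed.
Lemma ind_irr : irreflexive ind_adj.
Proof. by move=> a; rewrite /ind_adj gadj_irr. Qed.
Definition indg : graph := Graph ind_sym ind_irr.
Lemma simeq_indg (a b : gV indg) : simeq a b = simeq (val a) (val b).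
Proof. by rewrite /simeq /= /ind_adj val_eqE. Qed.
End Induced.

Section ReflexiveRelation.
Variables (V : finType) (r : rel V).
Hypotheses (r_sym : symmetric r) (r_refl : reflexive r).
(** Loops are removed here and put back by [simeq], so powers and disjoint unions can be specified
    directly by their relation [simeq]. *)
Definition refl_adj : rel V := fun a b => (a != b) && r a b.
Lemma refl_adj_sym : symmetric refl_adj.
Proof. by move=> a b; rewrite /refl_adj eq_sym r_sym. Qed.
Lemma refl_adj_irr : irreflexive refl_adj.
Proof. by move=> a; rewrite /refl_adj eqxx. Qed.
Definition refl_graph : graph := Graph refl_adj_sym refl_adj_irr.
Lemma simeq_refl_graph (a b : gV refl_graph) : simeq a b = r a b.
Proof. by rewrite /simeq /= /refl_adj; case: eqP => //= ->; rewrite r_refl. Qed.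
End ReflexiveRelation.

Lemma simeq_sprod (G H : graph) (a b : gV (sprod G H)) :
  simeq a b = simeq a.1 b.1 && simeq a.2 b.2.
Proof.
rewrite {1}/simeq /= /sprod_adj; case: eqP => //= ->.
by rewrite !simeqxx.
Qed.

Section Power.
Variables (G : graph) (n : nat).
Definition pow_rel : rel {ffun 'I_n -> gV G} :=
  fun a b => [forall i, simeq (a i) (b i)].
Lemma pow_rel_sym : symmetric pow_rel.
Proof. by move=> a b; apply/eq_forallb => i; rewrite simeq_sym. Qed.
Lemma pow_rel_refl : reflexive pow_rel.
Proof. by move=> a; apply/forallP => i; rewrite simeqxx. Qed.
Definition fpow : graph := refl_graph pow_rel_sym.
Lemma simeq_fpow (a b : gV fpow) :
  simeq a b = [forall i, simeq ((a : {ffun _ -> _}) i) ((b : {ffun _ -> _}) i)].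
Proof. exact/simeq_refl_graph/pow_rel_refl. Qed.
End Power.

Section Total.
Variable s : Arep.
Definition tvert : finType := {d : 'I_(size s) & gV (Ablock d)}.
Definition total_rel : rel tvert :=
  fun u v => (tag u == tag v) && simeq (tagged u) (tagged_as u v).
Lemma total_relT (d : 'I_(size s)) (x y : gV (Ablock d)) :
  total_rel (Tagged (fun d => gV (Ablock d)) x) (Tagged (fun d => gV (Ablock d)) y)
  = simeq x y.
Proof. by rewrite /total_rel /= eqxx /= tagged_asE. Qed.
Lemma total_rel_sym : symmetric total_rel.
Proof.
move=> [d x] [e y]; have [de|de] := eqVneq d e.
  by subst e; rewrite !total_relT simeq_sym.
by rewrite /total_rel /= (negbTE de) eq_sym (negbTE de).
Qed.
Lemma total_rel_refl : reflexive total_rel.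
Proof. by move=> [d x]; rewrite total_relT simeqxx. Qed.
Definition tgraph : graph := refl_graph total_rel_sym.
Definition tmult (v : gV tgraph) : nat := (tag (v : tvert)).+1.
End Total.

(** Counts are sums over positions, so that they split along concatenations and exchange with sums
    over letters; [cntE] matches them with the cardinalities in [typeclass]. *)
Definition cnt (V : finType) (n : nat) (x : {ffun 'I_n -> V}) (v : V) : nat :=
  (\sum_(i < n) (x i == v))%N.

Lemma sum_cnt (V : finType) n (x : {ffun 'I_n -> V}) : (\sum_v cnt x v = n)%N.
Proof.
rewrite /cnt exchange_big /=.
under eq_bigr => i _.
  rewrite (bigD1 (x i)) //= eqxx big1 ?addn0; last first.
    by move=> v /negbTE; rewrite eq_sym => ->.
  over.
by rewrite sum1_card card_ord.
Qed.

(** Induction on the length: some letter has positive count, it becomes the first letter, and its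
    count drops by one. *)
Lemma cnt_exists (V : finType) n (k : V -> nat) :
  (\sum_v k v = n)%N -> exists x : {ffun 'I_n -> V}, forall v, cnt x v = k v.
Proof.
elim: n k => [|n IHn] k sk.
  have noV (i : 'I_0) : V by case: i.
  exists [ffun i => noV i] => v; rewrite /cnt big_ord0.
  by apply/esym/eqP; move/eqP: sk; rewrite sum_nat_eq0 => /forallP /(_ v).
have [v0 v0P] : exists v0, (0 < k v0)%N.
  apply/existsP; apply: contraPT sk => /existsPn kz.
  rewrite big1 // => v _; apply/eqP; rewrite -leqn0 leqNgt; exact: kz.
have [|x xP] := IHn (fun v => k v - (v == v0))%N.
  move: sk; rewrite (bigD1 v0) //= => sk.
  rewrite (bigD1 v0) //= eqxx.
  rewrite (eq_bigr k) => [|v /negbTE ->]; last by rewrite subn0.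
  by move: sk; lia.
exists [ffun i => if unlift ord0 i is Some j then x j else v0] => v.
rewrite /cnt big_ord_recl ffunE unlift_none.
under eq_bigr => i _ do rewrite ffunE liftK.
have := xP v; rewrite /cnt => ->.
rewrite eq_sym; case: eqP => [->|_] /=; last by rewrite add0n subn0.
by rewrite addnC subnK.
Qed.

Definition ffcat (V : finType) n n' (x : {ffun 'I_n -> V}) (y : {ffun 'I_n' -> V}) :
  {ffun 'I_(n + n') -> V} :=
  [ffun i => match fintype.split i with inl a => x a | inr b => y b end].

Lemma ffcatl (V : finType) n n' (x : {ffun 'I_n -> V}) (y : {ffun 'I_n' -> V}) i :
  ffcat x y (lshift n' i) = x i.
Proof. by rewrite ffunE (unsplitK (inl i)). Qed.

Lemma ffcatr (V : finType) n n' (x : {ffun 'I_n -> V}) (y : {ffun 'I_n' -> V}) i :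
  ffcat x y (rshift n i) = y i.
Proof. by rewrite ffunE (unsplitK (inr i)). Qed.

Lemma cnt_cat (V : finType) n n' (x : {ffun 'I_n -> V}) (y : {ffun 'I_n' -> V}) v :
  cnt (ffcat x y) v = (cnt x v + cnt y v)%N.
Proof.
rewrite /cnt big_split_ord /=; congr (_ + _)%N; apply: eq_bigr => i _.
  by rewrite ffcatl.
by rewrite ffcatr.
Qed.

End Graphs.

(** * Spectral points on induced subgraphs and vertex partitions *)

Section Spectral.
Variables (R : realType) (f : graph -> R).
Hypothesis hf : spectralG f.

Lemma spec_ge0 G : 0 <= f G. Proof. by case: hf => f0 _; exact: f0. Qed.

Lemma spec_empty G : #|gV G| = 0%N -> f G = 0.
Proof. by case: hf => _ [f0 _ _ _ _]; exact: f0. Qed.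

Lemma spec_mono (H G : graph) (phi : gV H -> gV G) :
  (forall x y, simeq (phi x) (phi y) -> simeq x y) -> f H <= f G.
Proof. by case: hf => _ [_ _ _ _ fm] /graph_le_simeq /fm. Qed.

Lemma spec_ge1 (G : graph) (x : gV G) : 1 <= f G.
Proof.
have <- : f K1 = 1 by case: hf => _ [_ f1 _ _ _]; apply: f1; rewrite card_unit.
by apply: (@spec_mono K1 G (fun=> x)) => -[] [].
Qed.

Lemma spec_ind_mono (G G' : graph) (P : pred (gV G)) (P' : pred (gV G'))
    (phi : gV G -> gV G') :
  (forall x, P x -> P' (phi x)) ->
  (forall x y, P x -> P y -> simeq (phi x) (phi y) -> simeq x y) ->
  f (indg P) <= f (indg P').
Proof.
move=> PP' phiP.
apply: (@spec_mono (indg P) (indg P') (fun x => exist _ (phi (val x)) (PP' _ (valP x)))) => x y.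
by rewrite !simeq_indg /=; apply: phiP; apply: valP.
Qed.

Lemma spec_ind_eq (G : graph) (P P' : pred (gV G)) :
  P =1 P' -> f (indg P) = f (indg P').
Proof.
move=> PP'; apply/eqP; rewrite eq_le; apply/andP; split;
  apply: (@spec_ind_mono _ _ _ _ id) => // x; by rewrite PP'.
Qed.

Lemma spec_indT (G : graph) (P : pred (gV G)) : (forall x, P x) -> f (indg P) = f G.
Proof.
move=> PT; apply/eqP; rewrite eq_le; apply/andP; split.
  by apply: (@spec_mono (indg P) G val) => x y; rewrite simeq_indg.
apply: (@spec_mono G (indg P) (fun x => exist _ x (PT x))) => x y.
by rewrite simeq_indg.
Qed.

Lemma spec_ind0 (G : graph) (P : pred (gV G)) : P =1 xpred0 -> f (indg P) = 0.
Proof.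
move=> P0; apply: spec_empty; apply/eqP; rewrite card_sig cardE /= -cardE.
by apply/eqP/eq_card0.
Qed.

Section Partition.
Variables (G : graph) (K : eqType) (kap : gV G -> K).
Implicit Types (P : pred (gV G)) (r : seq K).

(** Splitting off one colour deletes the edges between that colour and the rest, and deleting edges
    can only increase [f]. *)
Lemma spec_ind_cons_le P k r : k \notin r ->
  f (indg (fun x => P x && (kap x \in k :: r))) <=
  f (indg (fun x => P x && (kap x == k))) + f (indg (fun x => P x && (kap x \in r))).
Proof.
move=> kr; case: (hf) => _ [_ _ <- _ _].
set H := indg _; set A := indg _; set B := indg _.
(* The map is chosen together with its defining property: the underlying vertex is kept. *)
have phi (x : gV H) : {y : gV (dunion A B) | match y with
     inl a => val a = val x | inr b => val b = val x end}.
  case: x => x /= Px; have /andP[Px1] := Px; rewrite inE.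
  case: (boolP (kap x == k)) => [xk _|xk xr].
    have H1 : P x && (kap x == k) by rewrite Px1.
    by exists (inl (exist _ x H1)).
  have H1 : P x && (kap x \in r) by rewrite Px1.
  by exists (inr (exist _ x H1)).
apply: (@spec_mono H _ (fun x => sval (phi x))) => x y.
case: (phi x) => -[a|a] /= ax; case: (phi y) => -[b|b] /= bx; rewrite /simeq //=;
  by rewrite /ind_adj -!val_eqE /= -ax -bx !val_eqE.
Qed.

Lemma spec_ind_sub P r : uniq r ->
  f (indg (fun x => P x && (kap x \in r))) <=
  \sum_(k <- r) f (indg (fun x => P x && (kap x == k))).
Proof.
elim: r => [|k r IHr] /=.
  by move=> _; rewrite big_nil spec_ind0 // => x; rewrite andbF.
move=> /andP[kr ur]; rewrite big_cons; apply: le_trans (spec_ind_cons_le P kr) _.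
by rewrite lerD2l; apply: IHr.
Qed.

Hypothesis kapP : forall x y, simeq x y -> kap x = kap y.

(** When colours are constant along edges, no edge joins the colour [k] to the rest, so the disjoint
    union embeds back. *)
Lemma spec_ind_cons_ge P k r : k \notin r ->
  f (indg (fun x => P x && (kap x == k))) + f (indg (fun x => P x && (kap x \in r))) <=
  f (indg (fun x => P x && (kap x \in k :: r))).
Proof.
move=> kr; case: (hf) => _ [_ _ <- _ _].
set H := indg _; set A := indg _; set B := indg _.
have phi (y : gV (dunion H A)) : {x : gV B | match y with
     inl a => val a = val x | inr b => val b = val x end}.
  case: y => -[x Px] /=; have /andP[Px1 Px2] := Px.
    have H1 : P x && (kap x \in k :: r) by rewrite Px1 inE Px2.
    by exists (exist _ x H1).
  have H1 : P x && (kap x \in k :: r) by rewrite Px1 inE Px2 orbT.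
  by exists (exist _ x H1).
apply: (@spec_mono _ B (fun x => sval (phi x))) => x y.
case: (phi x) => a; case: (phi y) => b; case: x => x; case: y => y /= yb xa.
- by rewrite simeq_indg /= -yb -xa => s; suff: simeq x y by []; rewrite simeq_indg.
- rewrite simeq_indg /= -yb -xa => /kapP xy; have /andP[_ /eqP xk] := valP x.
  by have /andP[_] := valP y; rewrite /= -xy xk (negbTE kr).
- rewrite simeq_indg /= -yb -xa => /kapP xy; have /andP[_ /eqP xk] := valP y.
  by have /andP[_] := valP x; rewrite /= xy xk (negbTE kr).
- by rewrite simeq_indg /= -yb -xa => s; suff: simeq x y by []; rewrite simeq_indg.
Qed.

Lemma spec_ind_add P r : uniq r ->
  f (indg (fun x => P x && (kap x \in r))) =
  \sum_(k <- r) f (indg (fun x => P x && (kap x == k))).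
Proof.
move=> ur; apply/eqP; rewrite eq_le spec_ind_sub //=.
elim: r ur => [|k r IHr] /=; first by rewrite big_nil spec_ge0.
move=> /andP[kr ur]; rewrite big_cons; apply: le_trans (spec_ind_cons_ge P kr).
by rewrite lerD2l; apply: IHr.
Qed.
End Partition.

End Spectral.

(** * Weighted graphs and type classes *)

Definition in_class (G : graph) n (k : gV G -> nat) : pred (gV (fpow G n)) :=
  fun x => [forall v, cnt x v == k v].

(** The functional [f_alpha] of a weighted graph, computed by multiplicity levels; [f_alpha_wval]
    identifies the two once the vertices of all blocks are collected in one graph. *)
Definition wval (R : realType) (f : graph -> R) (gam : R) (G : graph) (m : gV G -> nat) : R :=
  \sum_(D < (\max_v m v).+1) f (indg (fun v => m v == D)) * D%:R `^ gam.

Definition powmult (G : graph) (m : gV G -> nat) n (x : gV (fpow G n)) : nat :=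
  (\prod_(i < n) m ((x : {ffun _ -> _}) i))%N.

(** The multiplicity shared by all sequences with letter counts [k]. *)
Definition classmult (V : finType) (m k : V -> nat) : nat := (\prod_v m v ^ k v)%N.

Lemma powmult_class (G : graph) (m k : gV G -> nat) n (x : gV (fpow G n)) :
  in_class k x -> powmult m x = classmult m k.
Proof.
move=> /forallP xk; rewrite /powmult /classmult.
rewrite (partition_big (fun i => (x : {ffun _ -> _}) i) xpredT) //=.
apply: eq_bigr => v _; rewrite -(eqP (xk v)) /cnt.
rewrite (eq_bigr (fun=> m v)) => [|i /eqP -> //].
rewrite prod_nat_const; congr (_ ^ _)%N.
rewrite -sum1_card big_mkcond /=; apply: eq_bigr => i _.
by rewrite -[i \in _]/((x : {ffun _ -> _}) i == v); case: eqP.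
Qed.

Section Weighted.
Variables (R : realType) (f : graph -> R) (gam : R).
Hypothesis hf : spectralG f.

(** Levels above the maximum are empty and contribute zero, so weighted graphs with different maxima
    can be summed over a common range. *)
Lemma wvalE (G : graph) (m : gV G -> nat) N : (forall v, m v < N)%N ->
  wval f gam m = \sum_(D < N) f (indg (fun v => m v == D)) * D%:R `^ gam.
Proof.
move=> mN; rewrite /wval; pose t D := f (indg (fun v => m v == D)) * D%:R `^ gam.
have maxlt v : (m v < (\max_v m v).+1)%N by rewrite ltnS leq_bigmax.
have t0 D : (forall v, m v != D) -> t D = 0.
  by move=> h; rewrite /t spec_ind0 ?mul0r // => v; apply/negbTE.
have aux a b : (forall v, m v < a)%N -> (a <= b)%N -> \sum_(D < a) t D = \sum_(D < b) t D.
  move=> ma ab; rewrite -!(big_mkord xpredT) (big_cat_nat (leq0n a) ab) /=.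
  rewrite [X in _ = _ + X]big_nat_cond [X in _ = _ + X]big1 ?addr0 // => D.
  rewrite andbT => /andP[aD _]; apply: t0 => v; apply/eqP => mD.
  by have := ma v; rewrite mD ltnNge aD.
have [ab|/ltnW ab] := leqP (\max_v m v).+1 N; first exact: aux.
by apply/esym/aux.
Qed.

Lemma wval_ge0 (G : graph) (m : gV G -> nat) : 0 <= wval f gam m.
Proof. by apply: sumr_ge0 => D _; rewrite mulr_ge0 ?spec_ge0 ?powR_ge0. Qed.

Section Partition.
Variables (G : graph) (m : gV G -> nat) (K : finType) (kap : gV G -> K) (mu : K -> nat).
Hypothesis mE : forall v, m v = mu (kap v).

(** For a fixed colour [k] only the level [D = mu k] survives in the double sum; if [mu k] exceeds
    the maximum, no vertex has the colour [k]. *)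
Lemma wval_part_aux :
  \sum_k f (indg (fun v => kap v == k)) * (mu k)%:R `^ gam =
  \sum_(D < (\max_v m v).+1)
    (\sum_(k <- enum K) f (indg (fun v => (m v == D) && (kap v == k)))) * D%:R `^ gam.
Proof.
under [RHS]eq_bigr do rewrite mulr_suml.
rewrite exchange_big /= big_enum /=; apply: eq_bigr => k _.
have [kM|kM] := ltnP (mu k) (\max_v m v).+1.
  rewrite (bigD1 (Ordinal kM)) //= big1 ?addr0 => [|D Dk].
    congr (_ * _); apply: spec_ind_eq => // v; rewrite mE.
    by case: eqP => [->|]; rewrite ?eqxx ?andbF.
  rewrite spec_ind0 ?mul0r // => v; rewrite mE.
  case: (kap v =P k) => [->|]; rewrite ?andbF // andbT; apply/negbTE.
  by apply: contra Dk => /eqP kD; apply/eqP/val_inj.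
have kv v : (kap v == k) = false.
  apply/negbTE/eqP => kvk; move: kM; rewrite -kvk -mE.
  by rewrite ltnNge leq_bigmax.
rewrite (spec_ind0 hf kv) mul0r big1 // => D _.
by rewrite (spec_ind0 hf) ?mul0r // => v; rewrite kv andbF.
Qed.

Lemma ind_enumK (D : nat) : f (indg (fun v => m v == D)) =
  f (indg (fun v => (m v == D) && (kap v \in enum K))).
Proof. by apply: spec_ind_eq => // v; rewrite mem_enum andbT. Qed.

Lemma wval_sub : wval f gam m <= \sum_k f (indg (fun v => kap v == k)) * (mu k)%:R `^ gam.
Proof.
rewrite wval_part_aux; apply: ler_sum => D _; rewrite ler_wpM2r ?powR_ge0 //.
by rewrite ind_enumK; apply: (spec_ind_sub hf) (enum_uniq _).
Qed.

Lemma wval_part : (forall x y, simeq x y -> kap x = kap y) ->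
  wval f gam m = \sum_k f (indg (fun v => kap v == k)) * (mu k)%:R `^ gam.
Proof.
move=> kapP; rewrite wval_part_aux; apply: eq_bigr => D _; congr (_ * _).
by rewrite ind_enumK; apply: (spec_ind_add hf) (enum_uniq _).
Qed.
End Partition.

Lemma wval_const (G : graph) (m : gV G -> nat) D : (forall v, m v = D) ->
  wval f gam m = f G * D%:R `^ gam.
Proof.
move=> mD; rewrite (@wval_part G m unit (fun=> tt) (fun=> D)) //.
by rewrite (big_pred1 tt) => [|[] //]; rewrite spec_indT.
Qed.

Lemma wval_mono (G H : graph) (m : gV G -> nat) (m' : gV H -> nat) (phi : gV G -> gV H) :
  (forall x, m' (phi x) = m x) ->
  (forall x y, simeq (phi x) (phi y) -> simeq x y) ->
  wval f gam m <= wval f gam m'.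
Proof.
move=> mphi phiP; rewrite (@wvalE G m (\max_v m' v).+1) => [|v]; last first.
  by rewrite -mphi ltnS leq_bigmax.
apply: ler_sum => D _; rewrite ler_wpM2r ?powR_ge0 //.
apply: (spec_ind_mono hf (phi := phi)) => [x|x y _ _]; first by rewrite mphi.
exact: phiP.
Qed.

Lemma spec_ind_sprod (G H : graph) (P : pred (gV G)) (Q : pred (gV H)) :
  f (@indg (sprod G H) (fun v => P v.1 && Q v.2)) = f (indg P) * f (indg Q).
Proof.
have <- : f (sprod (indg P) (indg Q)) = f (indg P) * f (indg Q).
  by case: hf => _ [_ _ _ fM _]; apply: fM.
apply/eqP; rewrite eq_le; apply/andP; split.
  pose phi (x : gV (@indg (sprod G H) (fun v => P v.1 && Q v.2))) :
      gV (sprod (indg P) (indg Q)) :=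
    (exist P (val x).1 (proj1 (andP (valP x))), exist Q (val x).2 (proj2 (andP (valP x)))).
  by apply: (spec_mono hf (phi := phi)) => x y; rewrite simeq_sprod !simeq_indg simeq_sprod.
have pr (x : gV (sprod (indg P) (indg Q))) : P (val x.1) && Q (val x.2).
  by rewrite (valP x.1) (valP x.2).
pose phi (x : gV (sprod (indg P) (indg Q))) :
  gV (@indg (sprod G H) (fun v => P v.1 && Q v.2)) := exist _ (val x.1, val x.2) (pr x).
by apply: (spec_mono hf (phi := phi)) => x y; rewrite simeq_indg !simeq_sprod !simeq_indg.
Qed.

(** Colour a pair by its two levels: they are constant along edges, so the partition is additive,
    and each part is a product of level sets. *)
Lemma wval_sprod (G H : graph) (m : gV G -> nat) (m' : gV H -> nat) :
  (forall x y, simeq x y -> m x = m y) -> (forall x y, simeq x y -> m' x = m' y) ->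
  @wval R f gam (sprod G H) (fun x => m x.1 * m' x.2)%N = wval f gam m * wval f gam m'.
Proof.
move=> mP mP'; pose M := (\max_v m v).+1; pose M' := (\max_v m' v).+1.
(* Colours must form a finite type, hence [inord]; it truncates nothing, as levels stay below [M]
   and [M']. *)
pose kap (x : gV (sprod G H)) : 'I_M * 'I_M' := (inord (m x.1), inord (m' x.2)).
have i1 v : (inord (m v) : 'I_M) = m v :> nat by rewrite inordK // ltnS leq_bigmax.
have i2 v : (inord (m' v) : 'I_M') = m' v :> nat by rewrite inordK // ltnS leq_bigmax.
rewrite (@wval_part _ _ _ kap (fun ab => ab.1 * ab.2)%N).
- rewrite /wval mulr_suml.
  under [RHS]eq_bigr do rewrite mulr_sumr.
  rewrite pair_big /=; apply: eq_bigr => -[a b] _ /=.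
  rewrite natrM powRM // mulrACA -spec_ind_sprod; congr (_ * _).
  apply: spec_ind_eq => // -[x y] /=.
  by rewrite /kap xpair_eqE -!val_eqE /= i1 i2.
- by move=> [x y] /=; rewrite i1 i2.
- by move=> [x y] [x' y']; rewrite simeq_sprod /kap /= => /andP[/mP -> /mP' ->].
Qed.

Lemma wval_dunion (G H : graph) (m : gV G -> nat) (m' : gV H -> nat) :
  @wval R f gam (dunion G H)
     (fun x => match x with inl a => m a | inr b => m' b end)
  = wval f gam m + wval f gam m'.
Proof.
pose N := (\max_v m v + \max_v m' v).+1.
rewrite (@wvalE _ _ N) => [|[] x] /=; first last.
- by rewrite ltnS; apply: leq_trans (leq_addl _ _); exact: leq_bigmax.
- by rewrite ltnS; apply: leq_trans (leq_addr _ _); exact: leq_bigmax.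
rewrite (@wvalE G _ N) => [|x]; last first.
  by rewrite ltnS; apply: leq_trans (leq_addr _ _); exact: leq_bigmax.
rewrite (@wvalE H _ N) => [|x]; last first.
  by rewrite ltnS; apply: leq_trans (leq_addl _ _); exact: leq_bigmax.
rewrite -big_split /=; apply: eq_bigr => D _; rewrite -mulrDl; congr (_ * _).
set A := indg _; set B := indg _; set C := indg _.
have <- : f (dunion B C) = f B + f C by case: hf => _ [_ _ fD _ _]; apply: fD.
apply/eqP; rewrite eq_le; apply/andP; split.
  pose phi (x : gV A) : gV (dunion B C) :=
    match x with
    | exist (inl a) p => inl (exist _ a p)
    | exist (inr a) p => inr (exist _ a p) end.
  by apply: (spec_mono hf (phi := phi)) => -[[a|a] p] [[b|b] q].
pose phi (x : gV (dunion B C)) : gV A :=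
    match x with
    | inl a => exist _ (inl (val a)) (valP a)
    | inr a => exist _ (inr (val a)) (valP a) end.
by apply: (spec_mono hf (phi := phi)) => -[a|a] [b|b].
Qed.

Lemma powmult_simeq (G : graph) (m : gV G -> nat) n :
  (forall x y, simeq x y -> m x = m y) ->
  forall x y : gV (fpow G n), simeq x y -> powmult m x = powmult m y.
Proof.
move=> mP x y; rewrite simeq_fpow => /forallP xy.
by apply: eq_bigr => i _; apply: mP.
Qed.

(** Splitting off the first letter identifies the power [n.+1] with the product of [G] and the power
    [n]; the power [0] is a single vertex of multiplicity one. *)
Lemma wval_fpow (G : graph) (m : gV G -> nat) n :
  (forall x y, simeq x y -> m x = m y) ->
  wval f gam (@powmult G m n) = wval f gam m ^+ n.
Proof.
move=> mP; elim: n => [|n IHn].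
  rewrite (@wval_const _ _ 1%N) => [|x]; last by rewrite /powmult big_ord0.
  rewrite powR1 mulr1 expr0; case: hf => _ [_ f1 _ _ _]; apply: f1.
  by rewrite /= card_ffun card_ord.
rewrite exprS -IHn -wval_sprod //; last exact: powmult_simeq.
apply/eqP; rewrite eq_le; apply/andP; split.
  pose phi (x : gV (fpow G n.+1)) : gV (sprod G (fpow G n)) :=
    ((x : {ffun _ -> _}) ord0, [ffun i => (x : {ffun _ -> _}) (lift ord0 i)]).
  apply: (wval_mono (phi := phi)) => [x|x y] /=.
    rewrite /powmult big_ord_recl; congr (_ * _)%N.
    by apply: eq_bigr => i _; rewrite ffunE.
  rewrite simeq_sprod !simeq_fpow /= => /andP[xy0 /forallP xyS].
  apply/forallP => i; case: (unliftP ord0 i) => [j ->|-> //].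
  by have := xyS j; rewrite !ffunE.
pose phi (x : gV (sprod G (fpow G n))) : gV (fpow G n.+1) :=
  [ffun i => if unlift ord0 i is Some j then (x.2 : {ffun _ -> _}) j else x.1].
apply: (wval_mono (phi := phi)) => [x|x y] /=.
  rewrite /powmult big_ord_recl ffunE unlift_none; congr (_ * _)%N.
  by apply: eq_bigr => i _; rewrite ffunE liftK.
rewrite simeq_sprod !simeq_fpow /= => /forallP xy; apply/andP; split.
  by have := xy ord0; rewrite !ffunE unlift_none.
by apply/forallP => i; have := xy (lift ord0 i); rewrite !ffunE liftK.
Qed.

(** * Values on type classes *)

Section Classes.
Variables (G : graph).
Implicit Types (m k : gV G -> nat).

Definition Fc n k : R := f (indg (@in_class G n k)).

(** On a type class the multiplicity is constant, and the class is an induced subgraph of the power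
    with the same multiplicity. *)
Lemma Fc_le_wval m n k :
  (forall x y, simeq x y -> m x = m y) ->
  Fc n k * (classmult m k)%:R `^ gam <= wval f gam m ^+ n.
Proof.
move=> mP; rewrite -wval_fpow //.
set H := indg (@in_class G n k); pose phi (v : gV H) : gV (fpow G n) := val v.
have <- : wval f gam (fun v : gV H => powmult m (phi v)) =
          Fc n k * (classmult m k)%:R `^ gam.
  by apply: wval_const => v; apply: powmult_class (valP v).
by apply: (wval_mono (phi := phi)) => // x y; rewrite simeq_indg.
Qed.

(** Partition of the power by letter counts. Adjacent sequences may have different counts, so only
    subadditivity is available. Counts are at most [n], hence live in ['I_n.+1]. *)
Lemma wval_le_Fc m n :
  (forall x y, simeq x y -> m x = m y) ->
  wval f gam m ^+ n <= \sum_(k : {ffun gV G -> 'I_n.+1} | (\sum_v k v == n)%N)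
     Fc n (fun v => k v : nat) * (classmult m (fun v => k v : nat))%:R `^ gam.
Proof.
move=> mP; rewrite -wval_fpow //.
pose kap (x : gV (fpow G n)) : {ffun gV G -> 'I_n.+1} := [ffun v => inord (cnt x v)].
have kapE x v : kap x v = cnt x v :> nat.
  by rewrite ffunE inordK // ltnS -[leqRHS](sum_cnt x) (bigD1 v) //= leq_addr.
have kapC x (k : {ffun gV G -> 'I_n.+1}) : (kap x == k) = in_class (fun v => k v : nat) x.
  apply/eqP/forallP => [<- v|h]; first by apply/eqP; rewrite -kapE.
  by apply/ffunP => v; apply/val_inj; exact: etrans (kapE x v) (eqP (h v)).
have mE x : powmult m x = classmult m (fun v => kap x v : nat).
  by apply: powmult_class; rewrite -kapC.
apply: le_trans (wval_sub (mu := fun k : {ffun gV G -> 'I_n.+1} =>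
  classmult m (fun v => k v : nat)) mE) _.
rewrite [leRHS]big_mkcond /=; apply: ler_sum => k _; case: ifPn => sk.
  by rewrite /Fc (spec_ind_eq hf (fun x => kapC x k)).
rewrite spec_ind0 ?mul0r // => x; apply/negbTE; apply: contra sk => /eqP <-.
by under eq_bigr do rewrite kapE; rewrite sum_cnt.
Qed.

Lemma Fc_ge1 n k : (\sum_v k v = n)%N -> 1 <= Fc n k.
Proof.
move=> /cnt_exists[x xk]; have xP : @in_class G n k x by apply/forallP => v; rewrite xk.
exact: (spec_ge1 hf (exist _ x xP : gV (indg (@in_class G n k)))).
Qed.

(** Concatenation adds counts and reflects [simeq], since both halves can be read off. *)
Lemma Fc_mul n n' k k' : Fc n k * Fc n' k' <= Fc (n + n') (fun v => k v + k' v)%N.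
Proof.
rewrite /Fc -spec_ind_sprod.
pose phi (x : gV (sprod (fpow G n) (fpow G n'))) : gV (fpow G (n + n')) :=
  ffcat x.1 x.2.
apply: (spec_ind_mono hf (phi := phi)) => [x /andP[/forallP h /forallP h']|x y _ _].
  by apply/forallP => v; rewrite cnt_cat (eqP (h v)) (eqP (h' v)).
rewrite simeq_sprod !simeq_fpow => /forallP xy; apply/andP; split; apply/forallP => i.
  by have := xy (lshift n' i); rewrite /phi !ffcatl.
by have := xy (rshift n i); rewrite /phi !ffcatr.
Qed.

End Classes.

Lemma cnt_gt0 (V : finType) n (x : {ffun 'I_n -> V}) (i : 'I_n) : (0 < cnt x (x i))%N.
Proof. by rewrite /cnt (bigD1 i) //= eqxx. Qed.

Section Support.
Variables (G : graph) (P : pred (gV G)) (n : nat) (k : gV G -> nat).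
Hypothesis kP : forall v, (0 < k v)%N -> P v.
Let H := indg P.

(** A letter occurring in a sequence of the class has positive count, so the sequence lives in [H].
    With [P] the support of [k], all counts become positive, as [growth_cvg] requires. *)
Lemma Fc_ge_supp : Fc n k <= @Fc H n (fun v => k (val v)).
Proof.
have kx (x : gV (indg (@in_class G n k))) i : P ((val x : {ffun _ -> _}) i).
  apply: kP.
  by have /forallP/(_ ((val x : {ffun _ -> _}) i))/eqP <- := valP x; apply: cnt_gt0.
pose psi (x : gV (indg (@in_class G n k))) : gV (fpow H n) :=
  [ffun i => exist _ ((val x : {ffun _ -> _}) i) (kx x i)].
have psiP x : @in_class H n (fun v => k (val v)) (psi x).
  apply/forallP => v; have /forallP/(_ (val v))/eqP <- := valP x.
  by apply/eqP; apply: eq_bigr => i _; rewrite ffunE -val_eqE.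
pose phi x : gV (indg (@in_class H n (fun v => k (val v)))) := exist _ (psi x) (psiP x).
apply: (spec_mono hf (phi := phi)) => x y.
rewrite !simeq_indg !simeq_fpow => /forallP xy; apply/forallP => i.
by have := xy i; rewrite /= !ffunE simeq_indg.
Qed.

Lemma Fc_le_supp : @Fc H n (fun v => k (val v)) <= Fc n k.
Proof.
pose phi (x : gV (fpow H n)) : gV (fpow G n) :=
  [ffun i => val ((x : {ffun _ -> _}) i)].
apply: (spec_ind_mono hf (phi := phi)) => [x /forallP xk|x y _ _].
  apply/forallP => v; have [kv|/kP kv] := posnP (k v); last first.
    rewrite -[k v]/(k (val (exist _ v kv : gV H))) -(eqP (xk (exist _ v kv))).
    by apply/eqP; apply: eq_bigr => i _; rewrite ffunE -val_eqE.
  rewrite kv /cnt big1 // => i _; rewrite ffunE; case: eqP => //= xv.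
  have := cnt_gt0 (x : {ffun _ -> _}) i; rewrite (eqP (xk _)).
  by rewrite -[sval _]/(val _) in xv; rewrite /= xv kv.
rewrite !simeq_fpow => /forallP xy; apply/forallP => i.
by have := xy i; rewrite !ffunE simeq_indg.
Qed.

Lemma Fc_supp : @Fc H n (fun v => k (val v)) = Fc n k.
Proof. by apply/eqP; rewrite eq_le Fc_le_supp Fc_ge_supp. Qed.

Lemma sum_supp : (\sum_(v : gV H) k (val v) = \sum_v k v)%N.
Proof.
rewrite [RHS](bigID P) /= [X in (_ = _ + X)%N]big1 ?addn0.
  by rewrite (big_sub P k).
by move=> v; apply: contraNeq; rewrite -lt0n; apply: kP.
Qed.
End Support.

End Weighted.

(** * Noncommutative graphs of weighted graphs *)

Section Coordinates.
Variable R : realType.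
Local Notation C := R[i].

(* [N] is the noncommutative graph of the weighted graph [(G, m)]: its index set is
   the set of pairs [(v, i)] with [i < m v], and it is spanned by the [|u><v| (x) I]
   with [u ~= v]. *)
Record wcoord (N : ncgraph R) (G : graph) (m : gV G -> nat)
    (pv : ncI N -> gV G) (pi : ncI N -> nat) : Prop := Coord {
  co_lt : forall p, (pi p < m (pv p))%N;
  co_inj : forall p q, pv p = pv q -> pi p = pi q -> p = q;
  co_sur : forall v i, (i < m v)%N -> exists p, pv p = v /\ pi p = i;
  co_pos : forall v, (0 < m v)%N;
  co_simeq : forall u v, simeq u v -> m u = m v;
  co_S : forall X, @ncS R N X <-> exists c : gV G -> gV G -> C,
    (forall u v, ~~ simeq u v -> c u v = 0) /\
    (forall p q, X p q = c (pv p) (pv q) * (pi p == pi q)%:R) }.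

Definition coordinated (N : ncgraph R) (G : graph) (m : gV G -> nat) : Prop :=
  exists pv pi, @wcoord N G m pv pi.

Lemma coord_eq N G m pv pi (c : @wcoord N G m pv pi) p q :
  (p == q) = (pv p == pv q) && (pi p == pi q).
Proof.
apply/eqP/andP => [->|[/eqP h /eqP h']]; first by rewrite !eqxx.
exact: co_inj c _ _ h h'.
Qed.

(** Coordinates put the index set in bijection with the pairs [(v, i)] such that [i < m v]. *)
Lemma coord_sum N G m pv pi (c : @wcoord N G m pv pi) (F : gV G -> nat -> C) :
  \sum_p F (pv p) (pi p) = \sum_v \sum_(i < m v) F v i.
Proof.
rewrite (sig_big_dep xpredT (fun v => xpredT) (fun v (i : 'I_(m v)) => F v i)) /=.
pose e (p : ncI N) : {v : gV G & 'I_(m v)} :=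
  Tagged (fun v => 'I_(m v)) (Ordinal (co_lt c p)).
have e_inj : injective e.
  move=> p q epq; apply: (co_inj c).
    exact: (congr1 tag epq).
  exact: (congr1 (fun w : {v : gV G & 'I_(m v)} => tagged w : nat) epq).
have e_sur w : exists p, e p = w.
  case: w => v i; have [p [pvE piE]] := co_sur c (ltn_ord i).
  exists p; rewrite /e; move: (co_lt c p); rewrite pvE piE => lt.
  by congr (Tagged _ _); apply: val_inj.
have [e' e'K] := choice e_sur.
rewrite (reindex e) /=; last by exists e' => w _ //; apply: e_inj; rewrite e'K.
by [].
Qed.

Lemma coord_transport N G m pv pi (H : graph) (m' : gV H -> nat) (e : gV H -> gV G) :
  @wcoord N G m pv pi -> bijective e -> (forall x y, simeq (e x) (e y) = simeq x y) ->
  (forall x, m (e x) = m' x) -> coordinated N m'.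
Proof.
move=> c [e' eK e'K] eS me; exists (e' \o pv), pi; split => /=.
- by move=> p; rewrite -me e'K (co_lt c).
- by move=> p q h; apply: (co_inj c); apply: (can_inj e'K).
- move=> v i; rewrite -me => /(co_sur c)[p [pvE piE]]; exists p.
  by rewrite /= pvE eK.
- by move=> v; rewrite -me (co_pos c).
- by move=> u v; rewrite -eS -!me; apply: (co_simeq c).
- move=> X; rewrite (co_S c); split=> -[d [d0 dE]].
    exists (fun u v => d (e u) (e v)); split=> [u v|p q].
      by rewrite -eS; apply: d0.
    by rewrite !e'K.
  exists (fun u v => d (e' u) (e' v)); split=> [u v uv|p q]; last exact: dE.
  by apply: d0; rewrite -eS !e'K.
Qed.

Lemma tgraph_simeqT (s : Arep) (d : 'I_(size s)) (x y : gV (Ablock d)) :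
  @simeq (tgraph s) (Tagged (fun d => gV (Ablock d)) x) (Tagged (fun d => gV (Ablock d)) y)
  = simeq x y.
Proof. by rewrite simeq_refl_graph ?total_relT //; apply: total_rel_refl. Qed.

Lemma tgraph_simeq_tag (s : Arep) (u v : gV (tgraph s)) :
  simeq u v -> tag (u : tvert s) = tag (v : tvert s).
Proof.
rewrite simeq_refl_graph; last exact: total_rel_refl.
by case/andP => /eqP.
Qed.

(** The existential collapses: both entries carry the same multiplicity index. Comparing indices as
    natural numbers avoids their dependence on the block. *)
Lemma AgenopE (s : Arep) (k : Agen s) (p q : Aidx s) :
  Agenop R k p q =
  ([&& Tagged (fun d => gV (Ablock d)) (tagged p).1 ==
        Tagged (fun d => gV (Ablock d)) (tagged k).1 :> tvert s,
       Tagged (fun d => gV (Ablock d)) (tagged q).1 ==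
        Tagged (fun d => gV (Ablock d)) (tagged k).2 :> tvert s
     & (tagged p).2 == (tagged q).2 :> nat])%:R.
Proof.
rewrite /Agenop; congr (_%:R); congr nat_of_bool.
case: k => dk [x y].
apply/existsP/and3P => [[a /andP[/eqP -> /eqP ->]]|]; first by split => /=.
case: p => dp [u i]; case: q => dq [v j] [] /=.
move=> /eqP/[dup] /(congr1 tag) /= dpk; subst dp => /eqP.
rewrite eq_Tagged /= => /eqP ->.
move=> /eqP/[dup] /(congr1 tag) /= dqk; subst dq => /eqP.
rewrite eq_Tagged /= => /eqP -> /eqP ij.
by exists i; have -> : j = i by [apply: val_inj]; rewrite !eqxx.
Qed.

Lemma coord_Areal (s : Arep) :
  @wcoord (Areal R s) (tgraph s) (@tmult s)
    (fun p => Tagged (fun d => gV (Ablock d)) (tagged (p : Aidx s)).1)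
    (fun p => (tagged (p : Aidx s)).2 : nat).
Proof.
split.
- by move=> p /=; apply: ltn_ord.
- move=> [dp [u i]] [dq [v j]] /= /[dup] /(congr1 tag) /= dpq; subst dq.
  move=> /eqP; rewrite eq_Tagged /= => /eqP -> ij.
  by have -> : i = j by apply: val_inj.
- move=> [d v] i /= id.
  by exists (Tagged (fun d : 'I_(size s) => (gV (Ablock d) * 'I_d.+1)%type) (v, Ordinal id)).
- by [].
- by move=> u v /tgraph_simeq_tag uv; rewrite /tmult uv.
move=> X; split => [[c [c0 cE]]|[c [c0 cE]]].
- pose k1 (k : Agen s) : tvert s := Tagged (fun d => gV (Ablock d)) (tagged k).1.
  pose k2 (k : Agen s) : tvert s := Tagged (fun d => gV (Ablock d)) (tagged k).2.
  (* The coefficient of [|u><v| (x) I] collects all generators with end points [u] and [v]. *)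
  exists (fun u v => \sum_k c k * ((u == k1 k) && (v == k2 k))%:R); split=> [u v uv|p q].
    apply: big1 => k _; case: andP => [[/eqP uk /eqP vk]|]; last by rewrite mulr0.
    rewrite c0 ?mul0r //; move: uv; rewrite uk vk.
    by case: (k) => d [x y]; rewrite tgraph_simeqT.
  rewrite cE mulr_suml; apply: eq_bigr => k _; rewrite AgenopE -mulrA; congr (_ * _).
  by rewrite -natrM mulnb andbA.
exists (fun k => c (Tagged (fun d => gV (Ablock d)) (tagged k).1)
                   (Tagged (fun d => gV (Ablock d)) (tagged k).2)); split.
  by case=> d [x y] /= xy; apply: c0; rewrite tgraph_simeqT.
move=> p q; rewrite cE.
under eq_bigr do rewrite AgenopE.
set pv := Tagged _ _; set qv := Tagged _ _.
(* Between different blocks no generator has an entry, and [c] vanishes because [simeq] vertices lie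
   in one block. *)
have [tpq|tpq] := eqVneq (tag pv) (tag qv); last first.
  rewrite c0 ?mul0r; last by apply: contra tpq => /tgraph_simeq_tag ->.
  rewrite big1 // => -[d [x y]] _ /=.
  case: and3P => [[/eqP h1 /eqP h2 _]|]; last by rewrite mulr0.
  by move: tpq; rewrite h1 h2 eqxx.
case: p q @pv @qv tpq => dp [u i] [dq [v j]] /= tpq; subst dq.
rewrite (bigD1 (Tagged (fun d : 'I_(size s) => (gV (Ablock d) * gV (Ablock d))%type)
   (u, v))) //= !eqxx /= big1 ?addr0 // => -[d [x y]].
apply: contraNeq => /=.
case: and3P => [[/eqP h1 /eqP h2 _] _|]; last by rewrite mulr0 eqxx.
move: (congr1 tag h1) => /= dd; subst d.
move: h1 h2 => /eqP; rewrite eq_Tagged /= => /eqP <- /eqP.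
by rewrite eq_Tagged /= => /eqP <-.
Qed.

End Coordinates.

(** * Direct sums, tensor products, single blocks and isomorphisms *)

Section Constructions.
Variable R : realType.
Local Notation C := R[i].

Lemma coordinated_oplus (N N' : ncgraph R) (G H : graph) (m : gV G -> nat) (m' : gV H -> nat) :
  coordinated N m -> coordinated N' m' ->
  @coordinated R (nc_oplus N N') (dunion G H)
     (fun x => match x with inl a => m a | inr b => m' b end).
Proof.
move=> [pv [pi c]] [pv' [pi' c']].
exists (fun p : ncI N + ncI N' => match p with inl a => inl (pv a) | inr b => inr (pv' b) end).
exists (fun p : ncI N + ncI N' => match p with inl a => pi a | inr b => pi' b end).
split.
- by case=> p; [apply: co_lt c _|apply: co_lt c' _].
- case=> p [] q //= [h] h'; congr (_ _).
    exact: (co_inj c).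
  exact: (co_inj c').
- case=> v i /=.
    by move=> /(co_sur c)[p [pE iE]]; exists (inl p); rewrite pE iE.
  by move=> /(co_sur c')[p [pE iE]]; exists (inr p); rewrite pE iE.
- by case=> v; [apply: co_pos c _|apply: co_pos c' _].
- by case=> u [] v //= uv; [apply: (co_simeq c)|apply: (co_simeq c')].
move=> X; split.
  case=> /(co_S c)[d [d0 dE]] /(co_S c')[d' [d0' dE']] X12 X21.
  exists (fun u v : gV G + gV H => match u, v with
    | inl a, inl b => d a b | inr a, inr b => d' a b | _, _ => 0 end).
  split; first by case=> u [] v // uv; [apply: d0|apply: d0'].
  by case=> p [] q /=; rewrite ?X12 ?X21 ?mul0r // ?dE ?dE'.
case=> d [d0 dE]; split.
- apply/(co_S c); exists (fun u v => d (inl u) (inl v)); split => [u v uv|p q]; last exact: dE.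
  exact: d0.
- apply/(co_S c'); exists (fun u v => d (inr u) (inr v)); split => [u v uv|p q]; last exact: dE.
  exact: d0.
- by move=> a b; rewrite dE d0 ?mul0r.
- by move=> a b; rewrite dE d0 ?mul0r.
Qed.

Lemma mixed_radix_inj (a b i j k : nat) :
  (i < k)%N -> (j < k)%N -> (a * k + i = b * k + j)%N -> a = b /\ i = j.
Proof.
move=> ik jk e; have ab : a = b.
  move: (congr1 (fun x => x %/ k)%N e); rewrite !divnMDl ?(leq_ltn_trans _ ik) //.
  by rewrite !divn_small // !addn0.
by split=> //; move: e; rewrite ab => /addnI.
Qed.

(** The index pair [(i, i')] over [(x, x')] is coded in mixed radix as [i * m' x' + i']. *)
Lemma coordinated_otimes (N N' : ncgraph R) (G H : graph) (m : gV G -> nat) (m' : gV H -> nat) :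
  coordinated N m -> coordinated N' m' ->
  @coordinated R (nc_otimes N N') (sprod G H) (fun x => m x.1 * m' x.2)%N.
Proof.
move=> [pv [pi c]] [pv' [pi' c']].
exists (fun p : ncI N * ncI N' => (pv p.1, pv' p.2)).
exists (fun p : ncI N * ncI N' => pi p.1 * m' (pv' p.2) + pi' p.2)%N.
(* Codes over two vertices are compared digit by digit only when the radices agree, which holds for
   [simeq] vertices; for other pairs the coefficient is zero. *)
have piE (p q : ncI N * ncI N') : m' (pv' p.2) = m' (pv' q.2) ->
  (pi p.1 * m' (pv' p.2) + pi' p.2 == pi q.1 * m' (pv' q.2) + pi' q.2)%N =
  (pi p.1 == pi q.1) && (pi' p.2 == pi' q.2).
  move=> e; apply/eqP/andP => [|[/eqP -> /eqP ->]]; last by rewrite e.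
  rewrite e => /mixed_radix_inj[|| -> ->] //; last exact: (co_lt c').
  by rewrite -e (co_lt c').
split.
- move=> [p q] /=; apply: (@leq_trans ((pi p).+1 * m' (pv' q))%N).
    by rewrite mulSn addnC ltn_add2r (co_lt c').
  by rewrite leq_mul2r (co_lt c) orbT.
- move=> [p p'] [q q'] /= [h h'] /eqP; rewrite (piE (p, p') (q, q')) /= ?h' //.
  by move=> /andP[/eqP e /eqP e']; congr (_, _); [apply: (co_inj c)|apply: (co_inj c')].
- move=> [v v'] i /= ilt; have m0 := co_pos c' v'.
  have [p [pE iE]] : exists p, pv p = v /\ pi p = (i %/ m' v')%N.
    by apply: (co_sur c); rewrite ltn_divLR.
  have [q [qE jE]] : exists p, pv' p = v' /\ pi' p = (i %% m' v')%N.
    by apply: (co_sur c'); rewrite ltn_mod.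
  by exists (p, q); rewrite /= pE qE iE jE -divn_eq.
- by move=> [v v'] /=; rewrite muln_gt0 (co_pos c) (co_pos c').
- move=> [u u'] [v v']; rewrite simeq_sprod /= => /andP[h h'].
  by rewrite (co_simeq c h) (co_simeq c' h').
move=> X; split.
  case=> n [A [B [AB XE]]].
  have Ad k : exists d : gV G -> gV G -> C, (forall u v, ~~ simeq u v -> d u v = 0) /\
    (forall p q, A k p q = d (pv p) (pv q) * (pi p == pi q)%:R).
    by apply/(co_S c); case: (AB k).
  have Bd k : exists d : gV H -> gV H -> C, (forall u v, ~~ simeq u v -> d u v = 0) /\
    (forall p q, B k p q = d (pv' p) (pv' q) * (pi' p == pi' q)%:R).
    by apply/(co_S c'); case: (AB k).
  have {Ad}[d dP] := choice Ad; have {Bd}[d' dP'] := choice Bd.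
  exists (fun u v => \sum_k d k u.1 v.1 * d' k u.2 v.2); split.
    move=> u v; rewrite simeq_sprod negb_and => /orP[uv|uv]; rewrite big1 // => k _.
      by rewrite (proj1 (dP k)) ?mul0r.
    by rewrite (proj1 (dP' k)) ?mulr0.
  move=> p q /=; rewrite XE mulr_suml; apply: eq_bigr => k _.
  rewrite (proj2 (dP k)) (proj2 (dP' k)) mulrACA.
  have [pq|pq] := boolP (simeq (pv' p.2) (pv' q.2)).
    by rewrite -natrM mulnb piE // (co_simeq c' pq).
  by rewrite [d' _ _ _](proj1 (dP' k)) ?mulr0 ?mul0r.
case=> d [d0 dE].
(* Conversely [X] is decomposed into matrix units on the vertices, one elementary tensor for every
   quadruple of vertices; its coefficient goes to the first factor. *)
pose T : finType := ((gV G * gV G) * (gV H * gV H))%type.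
exists #|T|.
exists (fun k p q => let t : T := enum_val k in
  (if simeq t.1.1 t.1.2 then d (t.1.1, t.2.1) (t.1.2, t.2.2) else 0)
   * ((pv p == t.1.1) && (pv q == t.1.2))%:R * (pi p == pi q)%:R).
exists (fun k p q => let t : T := enum_val k in
  (simeq t.2.1 t.2.2)%:R * ((pv' p == t.2.1) && (pv' q == t.2.2))%:R * (pi' p == pi' q)%:R).
split.
  move=> k; set t := (enum_val k : T); split.
    apply/(co_S c).
    exists (fun u v => (if simeq t.1.1 t.1.2 then d (t.1.1, t.2.1) (t.1.2, t.2.2) else 0)
      * ((u == t.1.1) && (v == t.1.2))%:R); split => //.
    move=> u v; case: andP => [[/eqP -> /eqP ->] /negbTE ->|]; rewrite ?mul0r ?mulr0 //.
  apply/(co_S c').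
  exists (fun u v => (simeq t.2.1 t.2.2)%:R * ((u == t.2.1) && (v == t.2.2))%:R); split => //.
  move=> u v; case: andP => [[/eqP -> /eqP ->] /negbTE ->|]; rewrite ?mul0r ?mulr0 //.
move=> p q.
rewrite -(big_enum_val (A := T) (fun t : T =>
  ((if simeq t.1.1 t.1.2 then d (t.1.1, t.2.1) (t.1.2, t.2.2) else 0)
   * ((pv p.1 == t.1.1) && (pv q.1 == t.1.2))%:R * (pi p.1 == pi q.1)%:R) *
  ((simeq t.2.1 t.2.2)%:R * ((pv' p.2 == t.2.1) && (pv' q.2 == t.2.2))%:R
   * (pi' p.2 == pi' q.2)%:R))) /=.
rewrite (bigD1 (((pv p.1, pv q.1), (pv' p.2, pv' q.2)) : T)) //= !eqxx /= big1 => [|t tne].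
  rewrite addr0 !mulr1 dE /=.
  have [pq|pq] := boolP (simeq (pv p.1) (pv q.1)); last first.
    by rewrite d0 ?mul0r // simeq_sprod (negbTE pq).
  have [pq'|pq'] := boolP (simeq (pv' p.2) (pv' q.2)); last first.
    by rewrite d0 ?mul0r ?mulr0 // simeq_sprod (negbTE pq') andbF.
  by rewrite mul1r -mulrA -natrM mulnb piE // (co_simeq c' pq').
have [h|] := boolP ((pv p.1 == t.1.1) && (pv q.1 == t.1.2)); last by rewrite mulr0 !mul0r.
have [h'|] := boolP ((pv' p.2 == t.2.1) && (pv' q.2 == t.2.2)); last first.
  by rewrite mulr0 !(mul0r, mulr0).
case/negP: tne; move: t h h' => [[a b] [a' b']] /= /andP[/eqP -> /eqP ->] /andP[/eqP -> /eqP ->].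
by rewrite eqxx.
Qed.

Definition K0 : graph :=
  @Graph void (fun _ _ => false) (fun _ _ => erefl) (fun _ => erefl).

(* Represents [hat G (x) C_(D.+1)]. *)
Definition blk (G : graph) (D : nat) : Arep := rcons (nseq D K0) G.

Lemma size_blk G D : size (blk G D) = D.+1.
Proof. by rewrite size_rcons size_nseq. Qed.

Lemma nth_blk G D d : (d < D.+1)%N -> nth K1 (blk G D) d = if d == D then G else K0.
Proof.
rewrite ltnS leq_eqVlt nth_rcons size_nseq nth_nseq.
by case: ltngtP.
Qed.

Lemma f_alpha_blk (f : graph -> R) (hf : spectralG f) a G D :
  f_alpha f a (blk G D) = f G * D.+1%:R `^ a.
Proof.
rewrite /f_alpha /Ablock -(big_mkord xpredT (fun d => f (nth K1 (blk G D) d) * d.+1%:R `^ a)).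
rewrite size_blk big_nat_recr //= nth_blk // eqxx big_nat_cond big1 ?add0r // => d.
rewrite andbT => /andP[_ dD]; rewrite nth_blk ?ltnS ?(ltnW dD) // ltn_eqF //.
by rewrite (spec_empty hf) ?mul0r // card_void.
Qed.

Lemma coordinated_single (s : Arep) (d0 : 'I_(size s)) (H : graph) : Ablock d0 = H ->
  (forall d, d != d0 -> #|gV (Ablock d)| = 0%N) ->
  @coordinated R (Areal R s) H (fun=> d0.+1).
Proof.
move=> <- empt.
pose e (x : gV (Ablock d0)) : gV (tgraph s) := Tagged (fun d => gV (Ablock d)) x.
apply: (coord_transport (e := e) (coord_Areal R s)) => //.
  have sur w : exists x, e x = w.
    case: w => d y; have [dd|dd] := eqVneq d d0; first by subst d; exists y.
    by have := card0_eq (empt d dd) y; rewrite inE.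
  have [e' e'K] := choice sur.
  exists e' => // x; have /eqP := e'K (e x); rewrite eq_Tagged /=.
  by move=> /eqP.
by move=> x y; rewrite tgraph_simeqT.
Qed.

(** Makes a graph with constant multiplicity an element of the semiring, so that monotonicity of
    [f_alpha] can be applied to it. *)
Lemma coordinated_blk (G : graph) D :
  @coordinated R (Areal R (blk G D)) G (fun=> D.+1).
Proof.
have lt : (D < size (blk G D))%N by rewrite size_blk.
apply: (@coordinated_single (blk G D) (Ordinal lt)).
  by rewrite /Ablock nth_blk //= eqxx.
move=> d dne; rewrite /Ablock nth_blk; last by rewrite -(size_blk G D).
have /negbTE -> : (d : nat) != D by apply: contra dne => /eqP e; apply/eqP/val_inj.
by rewrite card_void.
Qed.

(** The blocks are the colour classes of the tag, and [simeq] vertices share their block. *)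
Lemma f_alpha_wval (f : graph -> R) (hf : spectralG f) a (s : Arep) :
  f_alpha f a s = wval f a (@tmult s).
Proof.
rewrite (@wval_part R f a hf _ _ _ (fun v : gV (tgraph s) => tag (v : tvert s)) (fun d => d.+1)) //.
  apply: eq_bigr => d _; congr (_ * _).
  apply/eqP; rewrite eq_le; apply/andP; split.
    pose phi (x : gV (Ablock d)) :
        gV (@indg (tgraph s) (fun v => tag (v : tvert s) == d)) :=
      exist _ (Tagged (fun d => gV (Ablock d)) x) (eqxx d).
    by apply: (spec_mono hf (phi := phi)) => x y; rewrite simeq_indg tgraph_simeqT.
  have sur (x : gV (@indg (tgraph s) (fun v => tag (v : tvert s) == d))) :
      exists y : gV (Ablock d), val x = Tagged (fun d => gV (Ablock d)) y.
    by case: x => -[e y] /= p; have := eqP p => /= q; subst e; exists y.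
  have [phi phiP] := choice sur.
  by apply: (spec_mono hf (phi := phi)) => x y; rewrite simeq_indg !phiP tgraph_simeqT.
exact: tgraph_simeq_tag.
Qed.

Lemma opadjK (I J : finType) (A : op R I J) : opadj (opadj A) = A.
Proof. by apply/funext => p; apply/funext => q; rewrite /opadj conjCK. Qed.

Lemma opmulA (I J K L : finType) (A : op R I J) (B : op R J K) (D : op R K L) :
  opmul A (opmul B D) = opmul (opmul A B) D.
Proof.
apply/funext => p; apply/funext => q; rewrite /opmul.
under eq_bigr do rewrite mulr_sumr.
under [RHS]eq_bigr do rewrite mulr_suml.
rewrite exchange_big; apply: eq_bigr => r _; apply: eq_bigr => t _.
by rewrite mulrA.
Qed.

Lemma opmul1 (I J : finType) (A : op R I J) : opmul A (@opid R J) = A.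
Proof.
apply/funext => p; apply/funext => q; rewrite /opmul /opid (bigD1 q) //= eqxx mulr1.
by rewrite big1 ?addr0 // => r /negbTE ->; rewrite mulr0.
Qed.

Lemma op1mul (I J : finType) (A : op R I J) : opmul (@opid R I) A = A.
Proof.
apply/funext => p; apply/funext => q; rewrite /opmul /opid (bigD1 p) //= eqxx mul1r.
by rewrite big1 ?addr0 // => r /negbTE; rewrite eq_sym => ->; rewrite mul0r.
Qed.

(** A unitary and its adjoint are cohomomorphisms with one operator each. Invariance under
    isomorphism thus comes from monotonicity. *)
Lemma nc_iso_le (S T : ncgraph R) : nc_iso S T -> nc_le S T /\ nc_le T S.
Proof.
move=> [U [U1 [U2 US]]].
have U1e : opmul (opadj U) U = @opid R _ by apply/funext => p; apply/funext => q.
have U2e : opmul U (opadj U) = @opid R _ by apply/funext => p; apply/funext => q.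
split.
  exists 1%N, (fun=> U); split => [p q|_ _ X SX]; first by rewrite big_ord1.
  apply/US; rewrite -!opmulA U2e opmul1 !opmulA U2e op1mul //.
exists 1%N, (fun=> opadj U); split => [p q|_ _ X SX].
  by rewrite big_ord1 opadjK.
by rewrite opadjK; apply/US.
Qed.

End Constructions.

(** * Cohomomorphisms between weighted graphs *)

Section MixedRadix.
Variables (n : nat) (delta : 'I_n -> nat).
Let M := (\max_i delta i).+1.
Let fam : pred {ffun 'I_n -> 'I_M} := family (fun i => [pred j : 'I_M | (j < delta i)%N]).

(** A number [a] below [\prod_i delta i] codes a tuple with entries less than [delta i], through the
    enumeration of all such tuples. The code depends on [delta] only, so sequences with equal
    multiplicities share it. *)
Definition dec (a : nat) (i : 'I_n) : nat := nth [ffun=> ord0] (enum fam) a i.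

Let deltaM i : (delta i <= M)%N.
Proof. by rewrite ltnW // ltnS leq_bigmax. Qed.

Lemma size_enum_dec : size (enum fam) = (\prod_i delta i)%N.
Proof.
rewrite -cardE -sum1_card.
transitivity (\sum_(f in fam) \prod_(i < n) 1)%N; first by apply: eq_bigr => f _; rewrite big1.
rewrite -(bigA_distr_big_dep (fun i (j : 'I_M) => (j < delta i)%N) (fun _ _ => 1%N)).
apply: eq_bigr => i _.
by rewrite -(big_ord_widen M (fun=> 1%N) (deltaM i)) sum1_card card_ord.
Qed.

Lemma dec_lt a i : (a < \prod_i delta i)%N -> (dec a i < delta i)%N.
Proof.
rewrite -size_enum_dec => /(mem_nth [ffun=> ord0]); rewrite mem_enum => /familyP/(_ i).
by rewrite inE.
Qed.

Lemma dec_inj a b : (a < \prod_i delta i)%N -> (b < \prod_i delta i)%N ->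
  (forall i, dec a i = dec b i) -> a = b.
Proof.
rewrite -size_enum_dec => ha hb ab; apply/eqP.
rewrite -(nth_uniq [ffun=> ord0] ha hb (enum_uniq _)); apply/eqP/ffunP => i.
exact: val_inj (ab i).
Qed.

Lemma dec_sum (A : comPzSemiRingType) (F : 'I_n -> nat -> A) :
  \sum_(a < \prod_i delta i) \prod_i F i (dec a i) = \prod_i \sum_(j < delta i) F i j.
Proof.
transitivity (\sum_(x in fam) \prod_i F i (x i)).
  by rewrite -size_enum_dec -[RHS]big_enum [RHS](big_nth [ffun=> ord0]) big_mkord.
under [RHS]eq_bigr => i _ do rewrite (big_ord_widen M (F i) (deltaM i)).
by rewrite bigA_distr_big_dep.
Qed.
End MixedRadix.

Section Cohomomorphisms.
Variable R : realType.
Local Notation C := R[i].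

(* The blocks [A x : C^(m x) -> C^(m' (phi x))] of a cohomomorphism between weighted graphs:
   isometries, whose mutual overlaps are scalar, and vanish for distinguishable vertices. *)
Record cohom (G G' : graph) (m : gV G -> nat) (m' : gV G' -> nat) (phi : gV G -> gV G')
    (A : gV G -> nat -> nat -> C) (c : gV G -> gV G -> C) : Prop := Cohom {
  ch_mul : forall x y, simeq (phi x) (phi y) ->
    forall b b', (b < m x)%N -> (b' < m y)%N ->
    \sum_(a < m' (phi x)) (A x a b)^* * A y a b' = c x y * (b == b')%:R;
  ch_0 : forall x y, ~~ simeq x y -> c x y = 0;
  ch_1 : forall x, c x x = 1 }.

Lemma coord_at (N : ncgraph R) G (m : gV G -> nat) pv pi : @wcoord R N G m pv pi ->
  exists at_ : gV G -> nat -> ncI N,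
    (forall v i, (i < m v)%N -> pv (at_ v i) = v /\ pi (at_ v i) = i) /\
    (forall p, at_ (pv p) (pi p) = p).
Proof.
move=> c.
have h (vi : gV G * nat) : exists p, (vi.2 < m vi.1)%N -> pv p = vi.1 /\ pi p = vi.2.
  have [lt|ge] := ltnP vi.2 (m vi.1).
    by have [p pP] := co_sur c lt; exists p.
  (* Out of range the value is a default, an index over [vi.1] that [co_pos] provides. *)
  by have [p pP] := co_sur c (co_pos c vi.1); exists p.
have [at_ atP] := choice h.
exists (fun v i => at_ (v, i)); split=> [v i lt|p]; first exact: atP (v, i) lt.
by have [h1 h2] := atP (pv p, pi p) (co_lt c p); apply: (co_inj c).
Qed.

Lemma sandwichE (I J K : finType) (E : op R I J) (F : op R I K) (X : op R I I) q q' :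
  opmul (opadj E) (opmul X F) q q' = \sum_p \sum_p' (E p q)^* * X p p' * F p' q'.
Proof.
rewrite /opmul /opadj; apply: eq_bigr => p _; rewrite mulr_sumr.
by apply: eq_bigr => p' _; rewrite mulrA.
Qed.

(** Overlaps are read off from [E_i^* X E_j] with [X = |phi x><phi y| (x) I]: membership in [N]
    forces a scalar block, zero for distinguishable [x] and [y]. Positive diagonal overlaps allow
    rescaling to isometries. *)
Lemma cohom_of_le (N N' : ncgraph R) (G G' : graph) (m : gV G -> nat) (m' : gV G' -> nat) :
  coordinated N m -> coordinated N' m' -> nc_le N N' ->
  exists phi A c, @cohom G G' m m' phi A c.
Proof.
move=> [pv [pi co]] [pv' [pi' co']] [n [E [E1 ES]]].
have [at_ [atP atK]] := coord_at co; have [at' [atP' atK']] := coord_at co'.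
(* The diagonal entry of [\sum_i E_i^* E_i] at [(x, 0)] is one, so some operator has a nonzero entry
   in that column; its row determines [phi x]. *)
have nz x : exists ip : 'I_n * ncI N', E ip.1 ip.2 (at_ x 0%N) != 0.
  apply: contrapT => h; have := E1 (at_ x 0%N) (at_ x 0%N); rewrite /opid eqxx big1.
    by move/eqP; rewrite eq_sym oner_eq0.
  move=> i _; apply: big1 => p _.
  have [->|z] := eqVneq (E i p (at_ x 0%N)) 0; first by rewrite mulr0.
  by case: h; exists (i, p).
have {nz}[ip ipP] := choice nz.
pose phi x := pv' (ip x).2.
pose A x a b : C := E (ip x).1 (at' (phi x) a) (at_ x b).
have hc (xy : gV G * gV G) : exists c : C, (~~ simeq xy.1 xy.2 -> c = 0) /\
   (simeq (phi xy.1) (phi xy.2) -> forall b b', (b < m xy.1)%N -> (b' < m xy.2)%N ->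
      \sum_(a < m' (phi xy.1)) (A xy.1 a b)^* * A xy.2 a b' = c * (b == b')%:R).
  case: xy => x y /=; have [s|] := boolP (simeq (phi x) (phi y)); last by exists 0; split.
  pose X : op R (ncI N') (ncI N') :=
    fun p q => ((pv' p == phi x) && (pv' q == phi y))%:R * (pi' p == pi' q)%:R.
  have SX : @ncS R N' X.
    apply/(co_S co'); exists (fun u v => ((u == phi x) && (v == phi y))%:R); split => // u v.
    by case: andP => // -[/eqP -> /eqP ->]; rewrite s.
  have /(co_S co)[d [d0 dE]] := ES (ip x).1 (ip y).1 X SX.
  exists (d x y); split=> [|_ b b' bx by']; first exact: d0.
  have [pb ib] := atP _ _ bx; have [pb' ib'] := atP _ _ by'.
  have := dE (at_ x b) (at_ y b'); rewrite pb pb' ib ib' => <-.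
  rewrite sandwichE.
  transitivity (\sum_v \sum_(i < m' v) \sum_v' \sum_(j < m' v')
    (E (ip x).1 (at' v i) (at_ x b))^* *
    (((v == phi x) && (v' == phi y))%:R * (i == j :> nat)%:R) *
    E (ip y).1 (at' v' j) (at_ y b')); last first.
    rewrite -(coord_sum co' (fun v i => \sum_v' \sum_(j < m' v')
      (E (ip x).1 (at' v i) (at_ x b))^* *
      (((v == phi x) && (v' == phi y))%:R * (i == j :> nat)%:R) *
      E (ip y).1 (at' v' j) (at_ y b'))).
    apply: eq_bigr => p _.
    rewrite -(coord_sum co' (fun v' j =>
      (E (ip x).1 (at' (pv' p) (pi' p)) (at_ x b))^* *
      (((pv' p == phi x) && (v' == phi y))%:R * (pi' p == j :> nat)%:R) *
      E (ip y).1 (at' v' j) (at_ y b'))).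
    by apply: eq_bigr => p' _; rewrite !atK'.
  rewrite [RHS](bigD1 (phi x)) //= [X in _ = _ + X]big1 ?addr0; last first.
    move=> v /negbTE vx; rewrite big1 // => i _; rewrite big1 // => v' _; rewrite big1 // => j _.
    by rewrite vx mul0r mulr0 mul0r.
  apply: eq_bigr => i _.
  rewrite (bigD1 (phi y)) //= [X in _ = _ + X]big1 ?addr0; last first.
    move=> v /negbTE vx; rewrite big1 // => j _.
    by rewrite vx andbF mul0r mulr0 mul0r.
  have iy : (i < m' (phi y))%N by rewrite -(co_simeq co' s).
  rewrite (bigD1 (Ordinal iy)) //= !eqxx /= mulr1 mulr1 big1 ?addr0 // => j ji.
  have /negbTE -> : (i : nat) != j.
    by apply: contra ji => /eqP ij; apply/eqP/val_inj.
  by rewrite mulr0 mulr0 mul0r.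
have {hc}[c cP] := choice hc.
(* At [b = b' = 0] the overlap is a sum of squared moduli that includes the nonzero entry chosen
   above. *)
have cpos x : 0 < c (x, x).
  have [_ /(_ (simeqxx _)) h] := cP (x, x).
  have := h 0%N 0%N (co_pos co x) (co_pos co x); rewrite mulr1 => /= <-.
  have lt := co_lt co' (ip x).2; rewrite -/(phi x) in lt.
  rewrite (bigD1 (Ordinal lt)) //= ltr_pwDl //.
    by rewrite mulrC -normCK exprn_gt0 // normr_gt0 /A atK'; apply: ipP.
  by apply: sumr_ge0 => a _; rewrite mulrC -normCK exprn_ge0.
pose s x := sqrtC (c (x, x)).
have spos x : 0 < s x by rewrite sqrtC_gt0.
have sconj x : (s x)^* = s x by apply: conj_Creal; rewrite gtr0_real.
exists phi, (fun x a b => A x a b / s x), (fun x y => c (x, y) / (s x * s y)); split.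
- move=> x y xy b b' bx by'; have [_ h] := cP (x, y).
  rewrite mulrAC -(h xy b b' bx by') mulr_suml; apply: eq_bigr => a _.
  by rewrite rmorphM /= fmorphV /= sconj invfM mulrACA.
- by move=> x y xy; have [h _] := cP (x, y); rewrite h ?mul0r.
- by move=> x; rewrite -expr2 sqrtCK divff // gt_eqF.
Qed.

(** One operator per vertex: [E x] carries the block [A x] from [x] to [phi x] and vanishes
    elsewhere. Isometry gives the normalization, scalar overlaps give the inclusion. *)
Lemma le_of_cohom (N N' : ncgraph R) (G G' : graph) (m : gV G -> nat) (m' : gV G' -> nat)
    phi A c :
  coordinated N m -> coordinated N' m' -> @cohom G G' m m' phi A c -> nc_le N N'.
Proof.
move=> [pv [pi co]] [pv' [pi' co']] ch.
pose E x : op R (ncI N') (ncI N) := fun p q =>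
  ((pv' p == phi x) && (pv q == x))%:R * A x (pi' p) (pi q).
have conjE x p q : (E x p q)^* =
    ((pv' p == phi x) && (pv q == x))%:R * (A x (pi' p) (pi q))^*.
  by rewrite rmorphM /= conjC_nat.
exists #|gV G|, (fun i => E (enum_val i)); split.
  move=> q q'; rewrite -(big_enum_val (A := gV G) (fun x => opmul (opadj (E x)) (E x) q q')) /=.
  rewrite (bigD1 (pv q)) //= big1 ?addr0 => [|x xq]; last first.
    by apply: big1 => p _; rewrite /opadj conjE [pv q == x]eq_sym (negbTE xq) andbF !mul0r.
  rewrite /opmul /opadj /opid.
  have [qq|qq] := eqVneq (pv q) (pv q'); last first.
    rewrite big1 => [|p _]; last by rewrite /E [pv q' == _]eq_sym (negbTE qq) andbF mul0r mulr0.
    by rewrite (coord_eq co) (negbTE qq).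
  transitivity (\sum_v \sum_(i < m' v) (v == phi (pv q))%:R *
     ((A (pv q) i (pi q))^* * A (pv q) i (pi q'))).
    rewrite -(coord_sum co' (fun v i => (v == phi (pv q))%:R *
     ((A (pv q) i (pi q))^* * A (pv q) i (pi q')))).
    apply: eq_bigr => p _; rewrite conjE /E -qq eqxx andbT.
    by case: eqP => _; rewrite ?mul1r ?mul0r.
  rewrite (bigD1 (phi (pv q))) //= [X in _ + X]big1 ?addr0; last first.
    by move=> v /negbTE ->; rewrite big1 // => i _; rewrite mul0r.
  rewrite eqxx; under eq_bigr do rewrite mul1r.
  rewrite (ch_mul ch (simeqxx _)) ?(co_lt co) //; last by rewrite qq (co_lt co).
  by rewrite (ch_1 ch) mul1r (coord_eq co) qq eqxx.
move=> i j X /(co_S co')[d [d0 dE]]; set x := enum_val i; set y := enum_val j.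
apply/(co_S co).
exists (fun u v => ((u == x) && (v == y))%:R * (d (phi x) (phi y) * c x y)); split.
  move=> u v uv; case: andP => [[/eqP ux /eqP vy]|]; last by rewrite mul0r.
  by rewrite (ch_0 ch) ?mulr0 // -ux -vy.
move=> q q'; rewrite sandwichE.
have [/andP[/eqP qx /eqP qy]|h] := boolP ((pv q == x) && (pv q' == y)); last first.
  rewrite !mul0r big1 // => p _; rewrite big1 // => p' _; rewrite conjE /E.
  move: h; rewrite negb_and => /orP[/negbTE ->|/negbTE ->]; first by rewrite andbF !mul0r.
  by rewrite andbF mul0r mulr0.
rewrite mul1r.
transitivity (\sum_v \sum_(a < m' v) \sum_w \sum_(b < m' w)
   ((v == phi x) && (w == phi y))%:R * ((A x a (pi q))^* * (d v w * (a == b :> nat)%:R)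
      * A y b (pi q'))).
  rewrite -(coord_sum co' (fun v a => \sum_w \sum_(b < m' w)
   ((v == phi x) && (w == phi y))%:R * ((A x a (pi q))^* * (d v w * (a == b :> nat)%:R)
      * A y b (pi q')))).
  apply: eq_bigr => p _.
  rewrite -(coord_sum co' (fun w b =>
   ((pv' p == phi x) && (w == phi y))%:R * ((A x (pi' p) (pi q))^*
      * (d (pv' p) w * (pi' p == b :> nat)%:R) * A y b (pi q')))).
  apply: eq_bigr => p' _; rewrite conjE /E dE qx qy !eqxx !andbT.
  by case: (pv' p == phi x); case: (pv' p' == phi y); rewrite /= ?(mul0r, mul1r, mulr0).
(* For distinguishable images [X] has no entry between them and both sides vanish; otherwise the
   overlap formula applies. *)
have [s|/d0 dz] := boolP (simeq (phi x) (phi y)); last first.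
  rewrite dz !mul0r big1 // => v _; rewrite big1 // => a _; rewrite big1 // => w _.
  rewrite big1 // => b _; case: andP => [[/eqP vx /eqP wy]|]; last by rewrite mul0r.
  have -> : d v w = 0 by rewrite vx wy.
  by rewrite !(mul0r, mulr0).
rewrite (bigD1 (phi x)) //= [X in _ + X]big1 ?addr0; last first.
  move=> v /negbTE vx; rewrite big1 // => a _; rewrite big1 // => w _; rewrite big1 // => b _.
  by rewrite vx mul0r.
rewrite -mulrA; have lx : (pi q < m x)%N by rewrite -qx (co_lt co).
have ly : (pi q' < m y)%N by rewrite -qy (co_lt co).
rewrite -(ch_mul ch s lx ly) mulr_sumr; apply: eq_bigr => a _.
rewrite (bigD1 (phi y)) //= [X in _ + X]big1 ?addr0; last first.
  move=> w /negbTE wy; rewrite big1 // => b _.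
  by rewrite wy andbF mul0r.
have ay : (a < m' (phi y))%N by rewrite -(co_simeq co' s).
rewrite (bigD1 (Ordinal ay)) //= !eqxx /= mul1r mulr1 big1 ?addr0 => [|b ba].
  by rewrite mulrA; congr (_ * _); rewrite mulrC.
have /negbTE -> : (a : nat) != b.
  by apply: contra ba => /eqP ab; apply/eqP/val_inj.
by rewrite !(mulr0, mul0r).
Qed.

Definition pushcnt (V W : finType) (phi : V -> W) (k : V -> nat) (w : W) : nat :=
  (\sum_(v | phi v == w) k v)%N.

Lemma cnt_push (V W : finType) (phi : V -> W) n (x : {ffun 'I_n -> V}) w :
  cnt [ffun i => phi (x i)] w = pushcnt phi (cnt x) w.
Proof.
rewrite /pushcnt /cnt exchange_big /=; apply: eq_bigr => i _; rewrite ffunE.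
have [h|h] := eqVneq (phi (x i)) w.
  rewrite (bigD1 (x i)) /= ?h // eqxx big1 // => v /andP[_ vx].
  by rewrite eq_sym (negbTE vx).
by rewrite big1 // => v /eqP vw; case: eqP => // xv; rewrite xv vw eqxx in h.
Qed.

(** * Tensor powers of the blocks on type classes *)

Section Powers.
Variables (G G' : graph) (m : gV G -> nat) (m' : gV G' -> nat) (phi : gV G -> gV G').
Variables (A : gV G -> nat -> nat -> C) (c : gV G -> gV G -> C).
Hypothesis ch : @cohom G G' m m' phi A c.
Hypothesis mP : forall x y, simeq x y -> m x = m y.
Hypothesis mP' : forall x y, simeq x y -> m' x = m' y.
Variables (n : nat) (k : gV G -> nat).
Let H := indg (@in_class G n k).
Let H' := indg (@in_class G' n (pushcnt phi k)).
Let ap (x : gV H) (i : 'I_n) : gV G := (val x : {ffun 'I_n -> gV G}) i.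

Lemma push_in_class (x : gV H) :
  @in_class G' n (pushcnt phi k) ([ffun i => phi (ap x i)] : {ffun 'I_n -> gV G'}).
Proof.
apply/forallP => w; rewrite cnt_push; apply/eqP; apply: eq_bigr => v _.
by have /forallP/(_ v)/eqP := valP x.
Qed.

Let Phi (x : gV H) : gV H' := 
  exist (@in_class G' n (pushcnt phi k)) [ffun i => phi (ap x i)] (push_in_class x).

(** The block of a sequence is the tensor product of the blocks of its letters; sums over coded
    tuples factor over positions by [dec_sum]. *)
Lemma cohom_pow :
  @cohom H H' (fun=> classmult m k) (fun=> classmult m' (pushcnt phi k)) Phi
    (fun x a b => \prod_(i < n) A (ap x i) (dec (fun i => m' (phi (ap x i))) a i)
                                          (dec (fun i => m (ap x i)) b i))
    (fun x y => \prod_(i < n) c (ap x i) (ap y i)).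
Proof.
have mE (x : gV H) : classmult m k = (\prod_(i < n) m (ap x i))%N.
  exact/esym/powmult_class/(valP x).
have mE' (x : gV H) : classmult m' (pushcnt phi k) = (\prod_(i < n) m' (phi (ap x i)))%N.
  rewrite -(powmult_class m' (push_in_class x)).
  by apply: eq_bigr => i _; rewrite ffunE.
have simH (x y : gV H) : simeq x y = [forall i, simeq (ap x i) (ap y i)].
  by rewrite simeq_indg simeq_fpow.
split.
- move=> x y; rewrite simeq_indg simeq_fpow => /forallP s b b' bx by'.
  have {}s i : simeq (phi (ap x i)) (phi (ap y i)) by have := s i; rewrite !ffunE.
  (* Since [m'] is constant along [simeq], the summation index is decoded alike for [x] and [y]. *)
  have -> : (fun i => m' (phi (ap y i))) = (fun i => m' (phi (ap x i))).
    by apply/funext => i; apply/esym/mP'.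
  under eq_bigr do rewrite rmorph_prod -big_split /=.
  rewrite (mE' x) (dec_sum (fun i => m' (phi (ap x i))) (fun i a =>
    (A (ap x i) a (dec (fun i => m (ap x i)) b i))^* *
     A (ap y i) a (dec (fun i => m (ap y i)) b' i))).
  rewrite (mE x) in bx; rewrite (mE y) in by'.
  under eq_bigr => i _.
    rewrite (ch_mul ch (s i)); first over; first exact: (dec_lt i bx).
    exact: (dec_lt i by').
  rewrite big_split /=.
  (* If some pair of letters is distinguishable, both sides vanish through [c]; otherwise the codes
     of [x] and [y] coincide, and equality of all digits means [b = b']. *)
  have [xy|] := boolP (simeq x y); last first.
    rewrite simH => /forallPn[i xyi].
    by rewrite [\prod_i c _ _](bigD1 i) //= (ch_0 ch xyi) !mul0r.
  congr (_ * _); move: xy; rewrite simH => /forallP xy.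
  have me : (fun i => m (ap y i)) = (fun i => m (ap x i)).
    by apply/funext => i; apply/esym/mP.
  rewrite me; have [->|bb'] := eqVneq b b'; first by rewrite big1 // => i _; rewrite eqxx.
  apply/eqP; apply: contraNT bb' => /prodf_neq0 h; apply/eqP.
  have e : (\prod_i m (ap y i) = \prod_i m (ap x i))%N.
    by apply: eq_bigr => i _; rewrite (mP (xy i)).
  apply: (dec_inj bx); first by rewrite -e.
  by move=> i; apply/eqP; have := h i isT; rewrite pnatr_eq0 eqb0 negbK.
- by move=> x y; rewrite simH => /forallPn[i /(ch_0 ch) h]; rewrite (bigD1 i) //= h mul0r.
- by move=> x; rewrite big1 // => i _; apply: (ch_1 ch).
Qed.
End Powers.

Lemma classmult_gt0 (V : finType) (m k : V -> nat) :
  (forall v, 0 < m v)%N -> (0 < classmult m k)%N.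
Proof. by move=> m0; apply: prodn_gt0 => v; rewrite expn_gt0 m0. Qed.

(** Type classes have constant multiplicity, so each side is the value of [f_alpha] at an element
    with one nonempty block, and the tensor power of the cohomomorphism compares the two
    elements. *)
Lemma Fc_cohom (f : graph -> R) a (G G' : graph) (m : gV G -> nat) (m' : gV G' -> nat)
    phi A c n k :
  spectralG f -> spectralA (f_alpha f a) ->
  @cohom G G' m m' phi A c ->
  (forall x y, simeq x y -> m x = m y) -> (forall x y, simeq x y -> m' x = m' y) ->
  (forall x, 0 < m x)%N -> (forall x, 0 < m' x)%N ->
  Fc f n k * (classmult m k)%:R `^ a <=
  Fc f n (pushcnt phi k) * (classmult m' (pushcnt phi k))%:R `^ a.
Proof.
move=> hf [_ [_ _ _ _ fm]] ch mP mP' m0 m0'.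
have ch' := cohom_pow ch mP mP' n k.
have D0 := classmult_gt0 k m0; have D0' := classmult_gt0 (pushcnt phi k) m0'.
(* [blk _ D] has multiplicity [D.+1], hence the predecessors. *)
rewrite -(prednK D0) -(prednK D0') in ch' *.
rewrite -!(f_alpha_blk hf); apply: fm.
exact: le_of_cohom (coordinated_blk _ _ _) (coordinated_blk _ _ _) ch'.
Qed.
End Cohomomorphisms.

(** * Growth rates of superadditive functions *)

Section Superadditive.
Import numFieldNormedType.Exports.
Local Open Scope classical_set_scope.
Variables (R : realType) (V : finType) (a : (V -> nat) -> R) (B : R).
Hypothesis a_ge0 : forall k, 0 <= a k.
Hypothesis a_add : forall k k', a k + a k' <= a (fun v => k v + k' v)%N.
Hypothesis a_bnd : forall k, a k <= B * (\sum_v k v)%:R.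

(** By superadditivity (Fekete) this supremum is the limit of [a] along the multiples [j k], divided
    by [j]. *)
Definition growth (k : V -> nat) : R :=
  sup [set x | exists j : nat, x = a (fun v => j.+1 * k v)%N / j.+1%:R].

Lemma a_mono k k' : (forall v, k v <= k' v)%N -> a k <= a k'.
Proof.
move=> kk'; have -> : k' = (fun v => k v + (k' v - k v))%N.
  by apply/funext => v; rewrite subnKC.
by apply: le_trans (a_add _ _); rewrite lerDl.
Qed.

Lemma a_mul i k : i%:R * a k <= a (fun v => i * k v)%N.
Proof.
elim: i => [|i IHi]; first by rewrite mul0r.
rewrite -natr1 mulrDl mul1r.
have -> : (fun v => i.+1 * k v)%N = (fun v => i * k v + k v)%N.
  by apply/funext => v; rewrite mulSn addnC.
by apply: le_trans (a_add _ _); rewrite lerD2r.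
Qed.

Lemma growth_has_sup k :
  has_sup [set x | exists j : nat, x = a (fun v => j.+1 * k v)%N / j.+1%:R].
Proof.
split; first by eexists; exists 0%N.
exists (B * (\sum_v k v)%:R) => _ [j ->].
rewrite ler_pdivrMr ?ltr0n // -mulrA -natrM mulnC big_distrr /=.
exact: a_bnd.
Qed.

Lemma growth_ge j k : a (fun v => j.+1 * k v)%N <= j.+1%:R * growth k.
Proof.
rewrite mulrC -ler_pdivrMr ?ltr0n //.
by apply: (sup_upper_bound (growth_has_sup k)); exists j.
Qed.

Lemma growth_ge1 k : a k <= growth k.
Proof.
by have := growth_ge 0 k; rewrite mul1r; under eq_fun do rewrite mul1n.
Qed.

Lemma growth_le k x : (forall j, a (fun v => j.+1 * k v)%N <= j.+1%:R * x) -> growth k <= x.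
Proof.
move=> h; apply: ge_sup; first by case: (growth_has_sup k).
by move=> _ [j ->]; rewrite ler_pdivrMr ?ltr0n // mulrC.
Qed.

Lemma growth_adherent k e : 0 < e ->
  exists j : nat, growth k - e < a (fun v => j.+1 * k v)%N / j.+1%:R.
Proof.
by move=> e0; have [_ [j ->] h] := sup_adherent e0 (growth_has_sup k); exists j.
Qed.

(** [kn n] is squeezed between multiples of [j.+1 * k], where [j] nearly attains the supremum, and
    multiples of [k]. Positivity of [k] turns convergence into a small relative error at every
    letter. *)
Lemma growth_cvg (k : V -> nat) (N : nat) (kn : nat -> V -> nat) :
  (0 < N)%N -> (forall v, 0 < k v)%N ->
  (forall v, (fun n => (kn n v)%:R / n.+1%:R : R) @ \oo --> ((k v)%:R / N%:R : R)) ->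
  (fun n => a (kn n) / n.+1%:R) @ \oo --> growth k / N%:R.
Proof.
move=> N0 k0 kcvg; apply/cvgrPdist_le => e e0.
set L := growth k; have L0 : 0 <= L by apply: le_trans (a_ge0 k) (growth_ge1 k).
have N0' : 0 < N%:R :> R by rewrite ltr0n.
have eN : 0 < e * N%:R by rewrite mulr_gt0.
(* The relative error [d] is chosen so that both [d < 1] and [d * (L / N) <= e / 3]. *)
pose d := e * N%:R / (3 * (L + 1) + e * N%:R).
have den : 0 < 3 * (L + 1) + e * N%:R by rewrite addr_gt0 // mulr_gt0 // ltr_wpDl.
have d0 : 0 < d by rewrite divr_gt0.
have d1 : d < 1 by rewrite ltr_pdivrMr // mul1r ltrDr mulr_gt0 // ltr_wpDl.
have dL : d * (L / N%:R) <= e / 3.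
  rewrite mulrA ler_pdivrMr // /d mulrAC ler_pdivrMr //.
  have : 0 <= e * N%:R * (e * N%:R) by rewrite mulr_ge0 // ltW.
  by lra.
have [j jP] := @growth_adherent k (e * N%:R / 3) (divr_gt0 eN (ltr0n R 3)).
rewrite -/L in jP; set A := a (fun v => j.+1 * k v)%N in jP.
have A0 : 0 <= A by apply: a_ge0.
have small M : 0 <= M -> \forall n \near \oo, M * n.+1%:R^-1 <= e / 3.
  move=> M0; have p0 : 0 < e / 3 / (M + 1) by rewrite !divr_gt0 // ltr_wpDl.
  near=> n; have : n.+1%:R^-1 < e / 3 / (M + 1).
    by near: n; exact: near_infty_natSinv_lt (PosNum p0).
  rewrite ltr_pdivlMr; last by rewrite ltr_wpDl.
  have : 0 <= (n.+1%:R^-1 : R) by rewrite invr_ge0.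
  by set y := _^-1 => y0 h; lra.
near=> n.
have hk v : `|(k v)%:R / N%:R - (kn n v)%:R / n.+1%:R| <= d * ((k v)%:R / N%:R) :> R.
  move: v; near: n; apply: filter_forall => v.
  have /cvgrPdist_le := kcvg v; apply.
  by rewrite mulr_gt0 // divr_gt0 // ltr0n.
have hL : L * n.+1%:R^-1 <= e / 3 by near: n; apply: small.
have hA : A * n.+1%:R^-1 <= e / 3 by near: n; apply: small.
have x0 : 0 < n.+1%:R :> R by rewrite ltr0n.
have y0 : 0 < n.+1%:R^-1 :> R by rewrite invr_gt0.
set x : R := n.+1%:R in hk hL hA x0 y0 *.
have up : a (kn n) / x <= L / N%:R + d * (L / N%:R) + L * x^-1.
  (* The multiple [t k] dominates [kn n]; rounding [t] up to [i.+1] costs at most one further [L],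
     which [hL] absorbs. *)
  pose t := (1 + d) * x / N%:R; have t0 : 0 <= t.
    by rewrite !mulr_ge0 ?invr_ge0 ?ltW // addr_gt0.
  have /andP[_ tlt] := truncn_itv t0; pose i := Num.truncn t.
  have ki v : (kn n v <= i.+1 * k v)%N.
    rewrite -(ler_nat R) natrM; apply: (@le_trans _ _ (t * (k v)%:R)); last first.
      by rewrite ler_wpM2r // ltW.
    have := hk v; rewrite ler_norml => /andP[h _].
    have {}h : (kn n v)%:R / x <= (1 + d) * ((k v)%:R / N%:R).
      by move: h; set w := (k v)%:R / N%:R; set z := (kn n v)%:R / x => h; lra.
    move: h; rewrite ler_pdivrMr // => h; apply: le_trans h _.
    by rewrite le_eqVlt; apply/orP; left; apply/eqP; rewrite /t; field; rewrite gt_eqF.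
  have h1 := le_trans (a_mono ki) (growth_ge i k).
  have h2 : i.+1%:R <= t + 1 by rewrite -natr1 lerD2r; have /andP[] := truncn_itv t0.
  have h3 : a (kn n) <= (t + 1) * L by apply: le_trans h1 _; rewrite ler_wpM2r.
  rewrite ler_pdivrMr //; apply: le_trans h3 _.
  rewrite le_eqVlt; apply/orP; left; apply/eqP; rewrite /t; field.
  by rewrite !gt_eqF.
have lo : (1 - d) * (A / j.+1%:R / N%:R) - A * x^-1 <= a (kn n) / x.
  (* Dually [t * j.+1 * k] lies below [kn n]; rounding [t] down loses at most one [A], which [hA]
     absorbs. *)
  pose t := (1 - d) * x / (N%:R * j.+1%:R).
  have j0 : 0 < j.+1%:R :> R by rewrite ltr0n.
  have t0 : 0 <= t.
    by rewrite !mulr_ge0 ?invr_ge0 ?mulr_ge0 ?ltW // subr_gt0.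
  have /andP[tle tlt] := truncn_itv t0; pose i := Num.truncn t.
  have ki v : (i * (j.+1 * k v) <= kn n v)%N.
    rewrite -(ler_nat R) !natrM; apply: (@le_trans _ _ (t * (j.+1%:R * (k v)%:R))).
      by rewrite ler_wpM2r // mulr_ge0.
    have := hk v; rewrite ler_norml => /andP[_ h].
    have {}h : (1 - d) * ((k v)%:R / N%:R) <= (kn n v)%:R / x.
      by move: h; set w := (k v)%:R / N%:R; set z := (kn n v)%:R / x => h; lra.
    move: h; rewrite ler_pdivlMr // => h; apply: le_trans h.
    by rewrite le_eqVlt; apply/orP; left; apply/eqP; rewrite /t; field; rewrite !gt_eqF.
  have h1 := le_trans (a_mul i _) (a_mono ki); rewrite -/A in h1.
  have h2 : t - 1 <= i%:R by rewrite lerBlDr natr1 ltW.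
  have h3 : (t - 1) * A <= a (kn n) by apply: le_trans h1; rewrite ler_wpM2r.
  rewrite ler_pdivlMr //; apply: le_trans h3.
  rewrite le_eqVlt; apply/orP; left; apply/eqP; rewrite /t; field.
  by rewrite !gt_eqF.
have jN : L / N%:R - e / 3 <= A / j.+1%:R / N%:R.
  rewrite ler_pdivlMr //; apply: le_trans (ltW jP).
  rewrite le_eqVlt; apply/orP; left; apply/eqP; field.
  by rewrite !gt_eqF.
have jN' : (1 - d) * (L / N%:R - e / 3) <= (1 - d) * (A / j.+1%:R / N%:R).
  by rewrite ler_wpM2l // subr_ge0 ltW.
have de : 0 <= d * (e / 3) by rewrite mulr_ge0 ?ltW // divr_gt0.
move: up lo jN' hA hL dL de.
set LN := L / N%:R; set w := A / _ / _; set Ax := A * _; set u := a _ / _.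
set Lx := L * _ => up lo jN' hA hL dL de.
have e1 : (1 - d) * (LN - e / 3) = LN - e / 3 - d * LN + d * (e / 3) by ring.
rewrite e1 in jN'; move: jN' lo up dL de.
set dLN := d * LN; set de3 := d * (e / 3); set dw := (1 - d) * w => jN' lo up dL de.
by rewrite ler_norml; apply/andP; split; lra.
Unshelve. all: by end_near.
Qed.

End Superadditive.

(** * Probabilistic refinement as a growth rate *)

Section Refinement.
Import numFieldNormedType.Exports.
Local Open Scope classical_set_scope.
Variables (R : realType) (f : graph -> R).
Hypothesis hf : spectralG f.

(** The length is the sum of the counts, which makes this a superadditive function of the counts
    alone. *)
Definition lnF (G : graph) (k : gV G -> nat) : R := ln (Fc f (\sum_v k v)%N k).

Lemma Fc_gt0 (G : graph) (k : gV G -> nat) n : (\sum_v k v = n)%N -> 0 < Fc f n k.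
Proof. by move=> h; apply: lt_le_trans ltr01 (Fc_ge1 hf h). Qed.

Lemma lnF_ge0 (G : graph) (k : gV G -> nat) : 0 <= lnF k.
Proof. by apply: ln_ge0; apply: Fc_ge1. Qed.

Lemma lnF_add (G : graph) (k k' : gV G -> nat) :
  lnF k + lnF k' <= lnF (fun v => k v + k' v)%N.
Proof.
rewrite /lnF -lnM ?posrE ?Fc_gt0 // ler_ln ?posrE ?mulr_gt0 ?Fc_gt0 //.
by rewrite big_split /=; apply: Fc_mul.
Qed.

(** The class is a subgraph of the power, whence [Fc f n k <= f G ^+ n]; this is [Fc_le_wval] with
    all multiplicities one. *)
Lemma lnF_bnd (G : graph) (k : gV G -> nat) : lnF k <= ln (f G) * (\sum_v k v)%:R.
Proof.
rewrite /lnF; move: (erefl (\sum_v k v)%N); move: {-2}(\sum_v k v)%N => n /esym kn.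
have F0 := Fc_gt0 kn.
have : Fc f n k <= f G ^+ n.
  have := @Fc_le_wval R f 0 hf G (fun=> 1%N) n k (fun _ _ _ => erefl).
  by rewrite (wval_const 0 hf (D := 1)) // !powRr0 !mulr1.
(* For [n = 0] the graph may be empty and [f G] zero, so logarithms of the bound are taken only for
   positive [n]. *)
case: n kn F0 => [|n] kn F0 Fle.
  rewrite mulr0; apply: ln_le0; exact: Fle.
have fG : 0 < f G.
  rewrite lt_neqAle (spec_ge0 hf) andbT eq_sym; apply/eqP => fG0.
  by move: (lt_le_trans F0 Fle); rewrite fG0 expr0n ltxx.
by rewrite mulr_natr -lnXn // ler_ln ?posrE ?exprn_gt0.
Qed.

Definition growthF (G : graph) (k : gV G -> nat) : R := growth (@lnF G) k.

Lemma cntE (V : finType) n (x : {ffun 'I_n -> V}) v : cnt x v = #|[set i | x i == v]|.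
Proof.
rewrite -sum1_card [RHS]big_mkcond /=; apply: eq_bigr => i _.
have -> : (i \in [set i | x i == v]) = (x i == v) by apply/idP/idP; rewrite in_setE.
by case: eqP.
Qed.

Lemma typegraph_Fc (G : graph) n (k : gV G -> nat) :
  f (@typegraph R G n.+1 (fun v => (k v)%:R / n.+1%:R)) = Fc f n.+1 k.
Proof.
set Q := fun v => _.
pose P : pred (gV (fpow G n.+1)) :=
  fun x => [forall v, #|[set i | (x : {ffun _ -> _}) i == v]|%:R == n.+1%:R * Q v].
have PE : P =1 in_class k.
  move=> x; apply: eq_forallb => v.
  by rewrite /Q mulrC divfK ?pnatr_eq0 // eqr_nat cntE.
rewrite /Fc -(spec_ind_eq hf PE).
have simE (x y : gV (@typegraph R G n.+1 Q)) :
    simeq x y = [forall i, simeq (val x i) (val y i)].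
  rewrite /simeq /= /tc_adj; case: eqP => //= ->.
  by apply/esym/forallP => i; rewrite eqxx.
apply/eqP; rewrite eq_le; apply/andP; split.
  pose phi (x : gV (@typegraph R G n.+1 Q)) : gV (indg P) := x.
  by apply: (spec_mono hf (phi := phi)) => x y; rewrite simeq_indg simeq_fpow simE.
pose phi (x : gV (indg P)) : gV (@typegraph R G n.+1 Q) := x.
by apply: (spec_mono hf (phi := phi)) => x y; rewrite simeq_indg simeq_fpow simE.
Qed.

Section FullSupport.
Variables (G : graph) (k : gV G -> nat) (N : nat).
Hypotheses (k_gt0 : forall v, (0 < k v)%N) (kN : (\sum_v k v = N)%N) (N_gt0 : (0 < N)%N).

(** Types converging to [k / N] yield counts to which [growth_cvg] applies; [expR] is continuous. *)
Lemma is_refine_growth :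
  is_refine f (fun v => (k v)%:R / N%:R) (expR (growthF k / N%:R)).
Proof.
move=> Qn Qt Qcvg.
have /choice[kn knP] n : exists k : gV G -> nat, forall x, Qn n x = (k x)%:R / n.+1%:R.
  by case: (Qt n).
have QnE n : Qn n = fun x => (kn n x)%:R / n.+1%:R by apply/funext => x.
have skn n : (\sum_v kn n v = n.+1)%N.
  case: (Qt n) => -[_]; rewrite QnE -mulr_suml -natr_sum => h _.
  apply/eqP; rewrite -(eqr_nat R); apply/eqP.
  by rewrite -[LHS](divfK (_ : n.+1%:R != 0)) ?pnatr_eq0 // h mul1r.
have -> : (fun n => f (@typegraph R G n.+1 (Qn n)) `^ n.+1%:R^-1) =
          (fun n => expR (lnF (kn n) / n.+1%:R)).
  apply/funext => n; rewrite QnE typegraph_Fc /lnF skn /powR gt_eqF ?Fc_gt0 //.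
  by rewrite mulrC.
have H : (fun n => lnF (kn n) / n.+1%:R) @ \oo --> (growthF k / N%:R : R).
  apply: (growth_cvg (@lnF_ge0 G) (@lnF_add G) (@lnF_bnd G)) => // v.
  by have := Qcvg v; under eq_fun do rewrite QnE.
exact: (cvg_comp _ _ H (@continuous_expR R _)).
Qed.

(** Write [n + 1 = q N + r] and take [q] copies of [k] and [r] further letters [v0]. Such a sequence
    shows that [is_refine] is not vacuous and has at most one value. *)
Lemma ntype_seq : exists kn : nat -> gV G -> nat,
  (forall n, \sum_v kn n v = n.+1)%N /\
  (forall v, (fun n => (kn n v)%:R / n.+1%:R : R) @ \oo --> ((k v)%:R / N%:R : R)).
Proof.
have [v0 _] : exists v0 : gV G, true.
  apply/existsP; apply: contraPT N_gt0 => /existsPn h.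
  by rewrite -kN big1 // => v; have := h v.
exists (fun n v => n.+1 %/ N * k v + (v == v0) * (n.+1 %% N))%N; split.
  move=> n; rewrite big_split /= -big_distrr /= kN -big_distrl /=.
  rewrite (bigD1 v0) //= eqxx big1 => [|v /negbTE -> //].
  by rewrite addn0 mul1n -divn_eq.
move=> v; apply/cvgrPdist_le => e e0.
have N0 : 0 < N%:R :> R by rewrite ltr0n.
have p0 : 0 < e / N%:R by rewrite divr_gt0.
near=> n; have : n.+1%:R^-1 < e / N%:R.
  by near: n; exact: near_infty_natSinv_lt (PosNum p0).
rewrite ltr_pdivlMr // => h.
have x0 : 0 < n.+1%:R :> R by rewrite ltr0n.
have E : n.+1%:R = (n.+1 %/ N)%:R * N%:R + (n.+1 %% N)%:R :> R.
  by rewrite -natrM -natrD -divn_eq.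
have r0 : (n.+1 %% N)%:R <= N%:R :> R by rewrite ler_nat ltnW // ltn_mod.
have kvN : (k v)%:R <= N%:R :> R by rewrite ler_nat -kN (bigD1 v) //= leq_addr.
set r : R := (n.+1 %% N)%:R in E r0 *; set q : R := (n.+1 %/ N)%:R in E.
have r1 : 0 <= r by rewrite ler0n.
rewrite natrD natrM -/q natrM -/r; set b : R := (v == v0)%:R.
have -> : (k v)%:R / N%:R - (q * (k v)%:R + b * r) / n.+1%:R =
          (r * ((k v)%:R / N%:R) - b * r) / n.+1%:R :> R.
  by rewrite E; field; rewrite -E !gt_eqF.
have w0 : 0 <= (k v)%:R / N%:R :> R by rewrite divr_ge0.
have w1 : (k v)%:R / N%:R <= 1 :> R by rewrite ler_pdivrMr // mul1r.
set w : R := (k v)%:R / N%:R in w0 w1 *.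
have rw0 : 0 <= r * w by rewrite mulr_ge0.
have rw1 : r * w <= r by rewrite ler_piMr.
have br : 0 <= b * r <= r.
  by rewrite /b; case: eqP => _; rewrite ?mul1r ?mul0r ?lexx ?r1.
have nr : `|r * w - b * r| <= N%:R.
  rewrite ler_norml; case/andP: br; move: rw0 rw1; set rw := r * w; set b1 := b * r => *.
  by apply/andP; split; lra.
rewrite normrM [`|n.+1%:R^-1|]ger0_norm ?invr_ge0 //.
apply: le_trans (ltW h); rewrite mulrC ler_wpM2l ?invr_ge0 //.
Unshelve. all: by end_near.
Qed.

(** [refine] picks a value satisfying [is_refine]: existence is [is_refine_growth], uniqueness is
    that of limits along the sequence of [ntype_seq]. *)
Lemma ln_refine : ln (refine f (fun v => (k v)%:R / N%:R)) = growthF k / N%:R.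
Proof.
set Q := fun v => _.
have ref : is_refine f Q (refine f Q).
  apply: (@xgetPex _ 0 [set v | is_refine f Q v]).
  by exists (expR (growthF k / N%:R)); exact: is_refine_growth.
have [kn [skn kncvg]] := ntype_seq.
pose Qn n (v : gV G) : R := (kn n v)%:R / n.+1%:R.
have Qt n : is_ntype n.+1 (Qn n).
  split; last by exists (kn n).
  split; first by move=> x; rewrite divr_ge0.
  by rewrite -mulr_suml -natr_sum skn divff // pnatr_eq0.
have h1 := ref Qn Qt kncvg; have h2 := is_refine_growth Qt kncvg.
by rewrite (cvg_unique (@norm_hausdorff _ _) h1 h2) expRK.
Qed.
End FullSupport.

Lemma growthF_supp (G : graph) (P : pred (gV G)) (k : gV G -> nat) :
  (forall v, (0 < k v)%N -> P v) ->
  @growthF (indg P) (fun v => k (val v)) = growthF k.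
Proof.
move=> kP; rewrite /growthF /growth; congr (sup _).
have E j : @lnF (indg P) (fun v => j.+1 * k (val v))%N = lnF (fun v => j.+1 * k v)%N.
  have kP' v : (0 < j.+1 * k v)%N -> P v by rewrite muln_gt0 => /kP.
  by rewrite /lnF (sum_supp kP') (Fc_supp hf _ kP').
by apply/seteqP; split=> x /= -[j ->]; exists j; rewrite E.
Qed.

End Refinement.

(** * Convexity *)

Lemma lnXn_natr (R : realType) n (x : R) : 0 < x -> ln (x ^+ n) = n%:R * ln x.
Proof. by move=> x0; rewrite lnXn // mulr_natl. Qed.

(** If [y < x], logarithms give [n * d <= c * ln (n + 1)] for all positive [n] with a fixed [d > 0],
    and linear growth beats the logarithm. *)
Lemma le_of_subexp (R : realType) (x y : R) (c : nat) : 0 <= x -> 0 <= y ->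
  (forall n, (0 < n)%N -> x ^+ n <= n.+1%:R ^+ c * y ^+ n) -> x <= y.
Proof.
move=> x0 y0 h; rewrite leNgt; apply/negP => yx.
have xp : 0 < x by apply: le_lt_trans yx.
have yp : 0 < y.
  rewrite lt_neqAle y0 andbT eq_sym; apply/eqP => yz.
  by have := h 1%N isT; rewrite yz expr1 mulr0 leNgt xp.
pose d := ln x - ln y; have d0 : 0 < d by rewrite subr_gt0 ltr_ln ?posrE.
have hl n : (0 < n)%N -> n%:R * d <= c%:R * ln n.+1%:R.
  move=> n0; have := h n n0.
  rewrite -ler_ln ?posrE ?mulr_gt0 ?exprn_gt0 ?ltr0n //.
  rewrite lnM ?posrE ?exprn_gt0 ?ltr0n // !lnXn_natr ?ltr0n // /d mulrBr.
  by rewrite lerBlDr.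
(* At [n + 1 = M^2] the logarithm is [2 ln M <= 2 (M - 1)], against [n = (M - 1)(M + 1)]. *)
have bnd M : (M.+3)%:R * d <= 2 * c%:R.
  have n0 : (0 < M.+2 * M.+2 - 1)%N by lia.
  have := hl _ n0; have -> : (M.+2 * M.+2 - 1).+1 = (M.+2 ^ 2)%N by rewrite mulnn; lia.
  have -> : (M.+2 * M.+2 - 1 = M.+1 * M.+3)%N by lia.
  rewrite natrX lnXn_natr ?ltr0n // natrM.
  have lnM2 : ln M.+2%:R <= M.+1%:R :> R.
    by rewrite -[M.+2%:R]natr1 addrC; apply: le_ln1Dx; rewrite (lt_le_trans (ltrN10 R)).
  have c0 : 0 <= c%:R :> R by [].
  move=> h1; rewrite -(ler_pM2l (_ : 0 < M.+1%:R)) ?ltr0n // mulrA.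
  apply: le_trans h1 _; rewrite mulrA [leRHS]mulrC [c%:R * 2]mulrC.
  by rewrite ler_wpM2l // mulr_ge0.
(* With [M] the integer part of [2 c / d] one has [2 c < (M + 1) d < (M + 3) d], against [bnd M]. *)
have := truncn_itv (divr_ge0 (mulr_ge0 (ler0n R 2) (ler0n R c)) (ltW d0)).
set M := Num.truncn _ => /andP[_]; rewrite ltr_pdivrMr // => h1.
have := bnd M; rewrite leNgt => /negP; apply; apply: lt_trans h1 _.
by rewrite ltr_pM2r // ltr_nat.
Qed.

Lemma classmultM (V : finType) (m k : V -> nat) j :
  classmult m (fun v => j * k v)%N = (classmult m k ^ j)%N.
Proof.
rewrite /classmult (big_morph (fun x => x ^ j)%N (fun x y => expnMn x y j) (exp1n j)).
by apply: eq_bigr => v _; rewrite mulnC expnM.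
Qed.

Lemma pushcntM (V W : finType) (phi : V -> W) (k : V -> nat) j :
  pushcnt phi (fun v => j * k v)%N = (fun w => j * pushcnt phi k w)%N.
Proof. by apply/funext => w; rewrite /pushcnt big_distrr. Qed.

Lemma sum_pushcnt (V W : finType) (phi : V -> W) (k : V -> nat) :
  (\sum_w pushcnt phi k w = \sum_v k v)%N.
Proof. by rewrite /pushcnt [RHS](partition_big phi xpredT). Qed.

(** * Growth rates under cohomomorphisms and convex combinations *)

Section Growth.
Variable R : realType.
Implicit Type f : graph -> R.

Lemma ln_Fc_powR f (hf : spectralG f) (G : graph) (k : gV G -> nat) (D : nat) a :
  (0 < D)%N ->
  ln (Fc f (\sum_v k v)%N k * D%:R `^ a) = lnF f k + a * ln D%:R.
Proof. by move=> D0; rewrite lnM ?posrE ?Fc_gt0 ?powR_gt0 ?ltr0n // ln_powR. Qed.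

(** [Fc_cohom] at the multiples [j.+1 * k], in logarithms: pushforwards and logarithms of
    multiplicities scale linearly, so dividing by [j.+1] the bound passes to the supremum. *)
Lemma growthF_cohom f a (G G' : graph) (m : gV G -> nat) (m' : gV G' -> nat) phi A c
    (k : gV G -> nat) :
  spectralG f -> spectralA (f_alpha f a) ->
  @cohom R G G' m m' phi A c ->
  (forall x y, simeq x y -> m x = m y) -> (forall x y, simeq x y -> m' x = m' y) ->
  (forall x, 0 < m x)%N -> (forall x, 0 < m' x)%N ->
  growthF f k + a * ln (classmult m k)%:R <=
  growthF f (pushcnt phi k) + a * ln (classmult m' (pushcnt phi k))%:R.
Proof.
move=> hf hA ch mP mP' m0 m0'; rewrite -lerBrDr.
apply: (growth_le (@lnF_bnd R f hf G)) => j.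
have := @Fc_cohom R f a G G' m m' phi A c (\sum_v j.+1 * k v)%N
  (fun v => j.+1 * k v)%N hf hA ch mP mP' m0 m0'.
have D0 := classmult_gt0 k m0; have D0' := classmult_gt0 (pushcnt phi k) m0'.
have s1 : (\sum_v j.+1 * k v = \sum_w j.+1 * pushcnt phi k w)%N.
  by rewrite -!big_distrr /= sum_pushcnt.
rewrite pushcntM !classmultM {2}s1.
have E0 : (0 < classmult m k ^ j.+1)%N by rewrite expn_gt0 D0.
have E0' : (0 < classmult m' (pushcnt phi k) ^ j.+1)%N by rewrite expn_gt0 D0'.
rewrite -ler_ln ?posrE ?mulr_gt0 ?Fc_gt0 ?powR_gt0 ?ltr0n //.
rewrite !ln_Fc_powR // !natrX !lnXn_natr ?ltr0n //.
have := growth_ge (@lnF_bnd R f hf G') j (pushcnt phi k); rewrite -/(growthF _ _).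
set x := lnF f _; set y := lnF f _; set g := growthF _ _.
set l := ln _; set l' := ln _; set J := j.+1%:R => h1 h2.
have -> : J * (g + a * l' - a * l) = J * g + a * (J * l') - a * (J * l) by ring.
by lra.
Qed.

(** [Fc_le_wval] at the multiples of [k]; the class of [k] is nonempty, which makes [wval] positive
    and its logarithm meaningful. *)
Lemma growthF_le_wval f (hf : spectralG f) a (G : graph) (m k : gV G -> nat) N :
  (forall x y, simeq x y -> m x = m y) -> (forall x, 0 < m x)%N ->
  (\sum_v k v = N)%N -> (0 < N)%N ->
  0 < wval f a m /\
  growthF f k + a * ln (classmult m k)%:R <= N%:R * ln (wval f a m).
Proof.
move=> mP m0 kN N0; have D0 := classmult_gt0 k m0.
have Z0 : 0 < wval f a m.
  rewrite lt_neqAle (wval_ge0 _ hf) andbT eq_sym; apply/eqP => z.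
  have := Fc_le_wval a hf N k mP; rewrite z expr0n (gtn_eqF N0) leNgt.
  by rewrite mulr_gt0 ?Fc_gt0 ?powR_gt0 ?ltr0n.
split=> //; rewrite -lerBrDr; apply: (growth_le (@lnF_bnd R f hf G)) => j.
have := Fc_le_wval a hf (\sum_v j.+1 * k v)%N (fun v => j.+1 * k v)%N mP.
have E0 : (0 < classmult m k ^ j.+1)%N by rewrite expn_gt0 D0.
rewrite classmultM.
rewrite -ler_ln ?posrE ?mulr_gt0 ?Fc_gt0 ?powR_gt0 ?ltr0n ?exprn_gt0 //.
rewrite !ln_Fc_powR // !natrX !lnXn_natr ?ltr0n // -big_distrr /= kN natrM.
set x := lnF f _; set l := ln _; set l' := ln _; set J := j.+1%:R => h.
have -> : J * (N%:R * l' - a * l) = J * N%:R * l' - a * (J * l) by ring.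
by lra.
Qed.

(** The hypothesis is applied to the distribution [k / N] on the support of [k], where [ln_refine]
    expresses each refinement by a growth rate. *)
Lemma growthF_convex f g h lambda :
  spectralG f -> spectralG g -> spectralG h ->
  (forall (G : graph) (P : gV G -> R), (0 < #|gV G|)%N -> is_dist P ->
     ln (refine h P) = lambda * ln (refine f P) + (1 - lambda) * ln (refine g P)) ->
  forall (G : graph) (k : gV G -> nat), (0 < \sum_v k v)%N ->
  growthF h k = lambda * growthF f k + (1 - lambda) * growthF g k.
Proof.
move=> hf hg hh conv G k; move E : (\sum_v k v)%N => N N0.
pose P : pred (gV G) := fun v => (0 < k v)%N.
have kP v : (0 < k v)%N -> P v by [].
rewrite -(growthF_supp hf kP) -(growthF_supp hg kP) -(growthF_supp hh kP).
have sN := sum_supp kP; rewrite E in sN.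
have k0 (v : gV (indg P)) : (0 < k (val v))%N by case: v.
have := conv (indg P) (fun v => (k (val v))%:R / N%:R).
rewrite (ln_refine hf k0 sN N0) (ln_refine hg k0 sN N0) (ln_refine hh k0 sN N0) => h1.
have N0' : N%:R != 0 :> R by rewrite pnatr_eq0 -lt0n.
apply: (mulIf (_ : N%:R^-1 != 0)); first by rewrite invr_eq0.
rewrite mulrDl -!mulrA; apply: h1.
  rewrite lt0n; apply: contraTneq N0 => V0; rewrite -sN big1 // => v.
  by have := card0_eq V0 v; rewrite inE.
split=> [v|]; first by rewrite divr_ge0.
by rewrite -mulr_suml -natr_sum sN divff.
Qed.

End Growth.

(** * Monotonicity and the semiring laws for the convex combination *)

Section Main.
Variables (R : realType) (f g h : graph -> R) (alpha beta lambda : R).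
Hypotheses (hf : spectralG f) (hg : spectralG g) (hh : spectralG h).
Hypotheses (fA : spectralA (f_alpha f alpha)) (gA : spectralA (f_alpha g beta)).
Hypothesis lambda01 : 0 <= lambda <= 1.
Hypothesis conv : forall (G : graph) (P : gV G -> R), (0 < #|gV G|)%N -> is_dist P ->
  ln (refine h P) = lambda * ln (refine f P) + (1 - lambda) * ln (refine g P).
Let gamma := lambda * alpha + (1 - lambda) * beta.

(** The map [phi] of one cohomomorphism serves [f] and [g] alike. The inequalities of
    [growthF_cohom], weighted by [lambda] and [1 - lambda], add up to the one for [h] with exponent
    [gamma]. *)
Lemma Fc_le_wval_cohom (G G' : graph) (m : gV G -> nat) (m' : gV G' -> nat) phi A c n
    (k : gV G -> nat) :
  @cohom R G G' m m' phi A c ->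
  (forall x y, simeq x y -> m x = m y) -> (forall x y, simeq x y -> m' x = m' y) ->
  (forall x, 0 < m x)%N -> (forall x, 0 < m' x)%N ->
  (\sum_v k v = n)%N -> (0 < n)%N ->
  Fc h n k * (classmult m k)%:R `^ gamma <= wval h gamma m' ^+ n.
Proof.
move=> ch mP mP' m0 m0' kn n0.
have D0 := classmult_gt0 k m0.
have sk : (\sum_w pushcnt phi k w = n)%N by rewrite sum_pushcnt.
have [Z0 hZ] := growthF_le_wval hh gamma mP' m0' sk n0.
have cf := growthF_cohom k hf fA ch mP mP' m0 m0'.
have cg := growthF_cohom k hg gA ch mP mP' m0 m0'.
have e1 : growthF h k = lambda * growthF f k + (1 - lambda) * growthF g k.
  by apply: growthF_convex => //; rewrite kn.
have e2 : growthF h (pushcnt phi k) = lambda * growthF f (pushcnt phi k)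
     + (1 - lambda) * growthF g (pushcnt phi k).
  by apply: growthF_convex => //; rewrite sk.
have l1 := growth_ge1 (@lnF_bnd R h hh G) k; rewrite -/(growthF h k) in l1.
rewrite -ler_ln ?posrE ?mulr_gt0 ?Fc_gt0 ?powR_gt0 ?ltr0n ?exprn_gt0 //.
rewrite lnXn_natr // -{1}kn ln_Fc_powR //; apply: le_trans hZ.
apply: (@le_trans _ _ (growthF h k + gamma * ln (classmult m k)%:R)); first by rewrite lerD2r.
rewrite e1 e2 /gamma; case/andP: lambda01 => la0 la1.
have cf' := ler_wpM2l la0 cf.
have la1' : 0 <= 1 - lambda by rewrite subr_ge0.
have cg' := ler_wpM2l la1' cg.
move: cf' cg'; set d := ln _; set d' := ln _ => cf' cg'.
by nra.
Qed.

(** The power is covered by at most [n.+1 ^ #|gV G|] type classes, each bounded by the power of the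
    right-hand side; [le_of_subexp] removes the polynomial factor. *)
Lemma wval_le (N N' : ncgraph R) (G G' : graph) (m : gV G -> nat) (m' : gV G' -> nat) :
  coordinated N m -> coordinated N' m' -> nc_le N N' ->
  wval h gamma m <= wval h gamma m'.
Proof.
move=> cN cN' le; have [phi [A [c ch]]] := cohom_of_le cN cN' le.
case: cN => pv [pi cN]; case: cN' => pv' [pi' cN'].
apply: (@le_of_subexp _ _ _ #|gV G|); rewrite ?(wval_ge0 _ hh) // => n n0.
apply: le_trans (wval_le_Fc gamma hh n (co_simeq cN)) _.
apply: (@le_trans _ _ (\sum_(k : {ffun gV G -> 'I_n.+1} | (\sum_v k v == n)%N)
   wval h gamma m' ^+ n)).
  apply: ler_sum => k /eqP kn.
  exact: (Fc_le_wval_cohom ch (co_simeq cN) (co_simeq cN') (co_pos cN) (co_pos cN')).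
rewrite sumr_const -[_ *+ #|_|]mulr_natl ler_wpM2r ?exprn_ge0 ?(wval_ge0 _ hh) //.
by rewrite -natrX ler_nat; apply: leq_trans (max_card _) _; rewrite card_ffun card_ord.
Qed.

Lemma wval_iso (N N' : ncgraph R) (G G' : graph) (m : gV G -> nat) (m' : gV G' -> nat) :
  coordinated N m -> coordinated N' m' -> nc_iso N N' ->
  wval h gamma m = wval h gamma m'.
Proof.
move=> cN cN' /nc_iso_le[le le']; apply/eqP.
by rewrite eq_le (wval_le cN cN' le) (wval_le cN' cN le').
Qed.

(** Invariance under isomorphism follows from monotonicity; sums and products are then computed on
    the models [dunion] and [sprod], where [wval] is additive and multiplicative. *)
Lemma spectralA_convex : spectralA (f_alpha h gamma).
Proof.
have cA s : coordinated (Areal R s) (@tmult s).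
  by do 2 eexists; exact: coord_Areal.
have tP s x y : simeq x y -> @tmult s x = @tmult s y.
  exact: co_simeq (coord_Areal R s) x y.
split; first by move=> s; rewrite f_alpha_wval // (wval_ge0 _ hh).
split.
- by rewrite /f_alpha big_ord0.
- rewrite /f_alpha big_ord1 powR1 mulr1.
  by case: hh => _ [_ h1 _ _ _]; apply: h1; rewrite card_unit.
- move=> s t u iso; rewrite !f_alpha_wval // -wval_dunion //.
  exact: wval_iso (cA u) (coordinated_oplus (cA s) (cA t)) iso.
- move=> s t u iso; rewrite !f_alpha_wval // -wval_sprod //; try exact: tP.
  exact: wval_iso (cA u) (coordinated_otimes (cA s) (cA t)) iso.
- move=> s t le; rewrite !f_alpha_wval //.
  exact: wval_le (cA t) (cA s) le.
Qed.
End Main.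

Theorem theorem4p2 (R : realType) (f g h : graph -> R) (alpha beta lambda : R) :
  spectralG f -> spectralG g -> spectralG h ->
  1 <= alpha -> 1 <= beta ->
  spectralA (f_alpha f alpha) -> spectralA (f_alpha g beta) ->
  0 <= lambda <= 1 ->
  (forall (G : graph) (P : gV G -> R), (0 < #|gV G|)%N -> is_dist P ->
     ln (refine h P) = lambda * ln (refine f P) + (1 - lambda) * ln (refine g P)) ->
  spectralA (f_alpha h (lambda * alpha + (1 - lambda) * beta)).
Proof. by move=> hf hg hh _ _ fA gA l01 conv; apply: spectralA_convex conv. Qed.
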